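(* Let $A$ be a regular (Noetherian) ring containing a field of characteristic $p>0$, and let $R=A[X_1,\ldots,X_n]$ be the standard $\mathbb{N}^n$-graded polynomial ring over $A$, i.e., $\deg(A)=\underline{0}\in\mathbb{N}^n$ and $\deg(X_j)=e_j\in\mathbb{N}^n$ for $j=1,\ldots,n$. Let $M=\bigoplus_{\underline{u}\in\mathbb{Z}^n}M_{\underline{u}}$ be a $\mathbb{Z}^n$-graded $\mathcal{F}$-finite $\mathcal{F}$-module over $R$. Let $U\subseteq\{1,\ldots,n\}$ be a subset and let $\mathcal{B}(U)=\{\underline{u}\in\mathbb{Z}^n\mid u_i\geq 0\text{ if }i\in U\text{ and }u_i\leq -1\text{ if }i\notin U\}$. Then: (i) For every prime ideal $\mathfrak{p}$ of $A$ and every $i\geq 0$, the Bass number $\mu_i(\mathfrak{p},M_{\underline{u}})$ is constant as $\underline{u}$ varies over $\mathcal{B}(U)$. (ii) The injective dimension $\operatorname{injdim}_A M_{\underline{u}}$, the dimension $\dim_A M_{\underline{u}}$ and the set of associated primes $\operatorname{Ass}_A M_{\underline{u}}$ are each constant as $\underline{u}$ varies over $\mathcal{B}(U)$.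
   Context: Here $e_j$ is the $j$-th standard basis vector of $\mathbb{Z}^n$. The Bass number is $\mu_i(\mathfrak{p},N)=\dim_{\kappa(\mathfrak{p})}\operatorname{Ext}^i_{A_{\mathfrak{p}}}(\kappa(\mathfrak{p}),N_{\mathfrak{p}})$ for an $A$-module $N$; $\dim_A N$ is the dimension of the support of $N$ (with one fixed convention for the zero module; likewise for injective dimension). For a regular Noetherian ring $R$ of characteristic $p>0$, let $R^1$ be the $(R,R)$-bimodule which is $R$ as an additive group, with the usual left multiplication and with right multiplication through the Frobenius map $a\mapsto a^p$. The Frobenius functor is $\mathcal{F}(M)=R^1\otimes_R M$ on $R$-modules, with $\mathcal{F}(f)=\mathrm{id}\otimes f$; $\mathcal{F}^e$ denotes its $e$-th iterate. An $\mathcal{F}$-module over $R$ is an $R$-module $M$ with an $R$-module isomorphism $\theta:M\to\mathcal{F}(M)$. An $\mathcal{F}$-module is $\mathcal{F}$-finite if it is of the form $M=\varinjlim\left(U\xrightarrow{\beta}\mathcal{F}(U)\xrightarrow{\mathcal{F}(\beta)}\mathcal{F}^2(U)\to\cdots\right)$ for a finitely generated $R$-module $U$ and an $R$-linear map $\beta:U\to\mathcal{F}(U)$ (a generating morphism), with the structure isomorphism $M\cong\mathcal{F}(M)$ induced by shifting the direct system. If $R$ is $\mathbb{Z}^n$-graded and $M$ is a $\mathbb{Z}^n$-graded $R$-module, then $\mathcal{F}(M)$ is $\mathbb{Z}^n$-graded by $\deg(r\otimes m)=\deg(r)+p\deg(m)$ for homogeneous $r\in R$, $m\in M$. A $\mathbb{Z}^n$-graded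 $\mathcal{F}$-finite $\mathcal{F}$-module is one arising as such a direct limit with the finitely generated module graded and $\beta$ degree preserving, with the induced grading on $M$. *)

(* Defs.v *)
From HB Require Import structures.
From mathcomp Require Import all_boot all_order all_algebra.
From mathcomp Require Import generic_quotient ring_quotient.
From mathcomp.multinomials Require Import freeg mpoly.
From mathcomp Require Import ring.
From mathcomp Require Import boolp classical_sets functions constructive_ereal.

Set Implicit Arguments.
Unset Strict Implicit.
Unset Printing Implicit Defensive.

Import Order.TTheory GRing.Theory Num.Theory.
Local Open Scope ring_scope.
Local Open Scope quotient_scope.
Local Open Scope classical_set_scope.

Definition subm (R : pzRingType) (V : lmodType R) (S : submodClosed V) : Type :=
  {x : V | x \in S}.

Section Subm.
Variables (R : pzRingType) (V : lmodType R) (S : submodClosed V).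
HB.instance Definition _ := [isSub of subm S for (@sval _ _ : subm S -> V)].
HB.instance Definition _ := [Choice of subm S by <:].
HB.instance Definition _ := [SubChoice_isSubLmodule of subm S by <:].
Definition subm_in (x : V) (Sx : x \in S) : subm S :=
  exist (fun x => is_true (x \in S)) x Sx.
Lemma submZ a (x : subm S) : \val (a *: x) = a *: \val x.
Proof. by []. Qed.
End Subm.

(* [submodClosed] only records additive and scalar closedness; {quot _} asks
   for closedness under opposites. *)
Definition smod (R : pzRingType) (V : lmodType R) (S : submodClosed V) :
  {pred V} := S.
HB.instance Definition _ (R : pzRingType) (V : lmodType R)
  (S : submodClosed V) :=
  GRing.isZmodClosed.Build V (smod S) (GRing.submod_closedB (submodClosedP S)).

Definition quotm (R : pzRingType) (V : lmodType R) (S : submodClosed V) : Type :=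
  Quotient.quot (smod S).

Section Quotm.
Variables (R : pzRingType) (V : lmodType R) (S : submodClosed V).
HB.instance Definition _ := GRing.Zmodule.on (quotm S).

Definition projm (x : V) : quotm S := \pi_(Quotient.quot (smod S)) x.
Definition reprm (x : quotm S) : V := repr (x : Quotient.quot (smod S)).

Lemma projmK (x : quotm S) : projm (reprm x) = x.
Proof. exact: reprK. Qed.

Lemma projm_eq (x y : V) : projm x = projm y <-> x - y \in S.
Proof.
rewrite -[x - y \in S]/(x - y \in smod S) Quotient.idealrBE.
by split=> [e|/eqP]; first apply/eqP.
Qed.

Lemma projmB : {morph projm : x y / x - y}.
Proof. by move=> x y; rewrite /projm raddfB. Qed.

Lemma projmD : {morph projm : x y / x + y}.
Proof. by move=> x y; rewrite /projm raddfD. Qed.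

Lemma reprm_proj x : reprm (projm x) - x \in S.
Proof. by apply/projm_eq; rewrite projmK. Qed.

Definition scalem (a : R) (x : quotm S) : quotm S := projm (a *: reprm x).

Lemma scalemE a x : scalem a (projm x) = projm (a *: x).
Proof. by apply/projm_eq; rewrite -scalerBr rpredZ // reprm_proj. Qed.

Let scalemA a b v : scalem a (scalem b v) = scalem (a * b) v.
Proof. by rewrite -[v]projmK !scalemE scalerA. Qed.
Let scale1m : left_id 1 scalem.
Proof. by move=> v; rewrite -[v]projmK scalemE scale1r. Qed.
Let scalemDr : right_distributive scalem +%R.
Proof.
by move=> a u v; rewrite -[u]projmK -[v]projmK -projmD !scalemE scalerDr projmD.
Qed.
Let scalemDl v : {morph scalem^~ v : a b / a + b}.
Proof. by move=> a b; rewrite -[v]projmK !scalemE scalerDl projmD. Qed.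
HB.instance Definition _ := GRing.Zmodule_isLmodule.Build R (quotm S)
  scalemA scale1m scalemDr scalemDl.

Lemma projm_linear : linear projm.
Proof. by move=> a x y; rewrite projmD -scalemE. Qed.
HB.instance Definition _ := GRing.isLinear.Build R V (quotm S) _ projm projm_linear.

Section Lift.
Variables (W : lmodType R) (g : {linear V -> W}).
Hypothesis g0 : forall x, x \in S -> g x = 0.
Lemma quotm_liftE x : g (reprm (projm x)) = g x.
Proof. by apply/eqP; rewrite -subr_eq0 -linearB; apply/eqP/g0/reprm_proj. Qed.
Lemma quotm_lift_linear : linear (fun x : quotm S => g (reprm x)).
Proof.
move=> a x y; rewrite -[x]projmK -[y]projmK -linearP !quotm_liftE.
by rewrite linearP.
Qed.
End Lift.
End Quotm.

Section Span.
Variables (R : pzRingType) (V : lmodType R) (G : set V).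
Definition lspan : {pred V} := fun x =>
  `[< exists2 s : seq (R * V),
      (forall c, c \in s -> G c.2) & x = \sum_(c <- s) c.1 *: c.2 >].
Lemma lspan_closed : submod_closed lspan.
Proof.
split; first by apply/asboolP; exists [::] => //; rewrite big_nil.
move=> a x y /asboolP[s Gs ->] /asboolP[t Gt ->]; apply/asboolP.
exists ([seq (a * c.1, c.2) | c <- s] ++ t).
  by move=> c; rewrite mem_cat => /orP[/mapP[d /Gs Gd ->]|/Gt].
rewrite big_cat big_map scaler_sumr; congr (_ + _).
by apply: eq_bigr => c _; rewrite scalerA.
Qed.
HB.instance Definition _ := GRing.isSubmodClosed.Build R V lspan lspan_closed.
End Span.

Section SpanTheory.
Variables (R : pzRingType) (V : lmodType R).
Lemma mem_lspan (G : set V) x : G x -> x \in lspan G.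
Proof.
move=> Gx; apply/asboolP; exists [:: (1, x)]; last by rewrite big_seq1 scale1r.
by move=> c; rewrite inE => /eqP ->.
Qed.

Lemma lspan_lift0 (W : lmodType R) (g : {linear V -> W}) (G : set V) :
  (forall x, G x -> g x = 0) -> forall x, x \in lspan G -> g x = 0.
Proof.
move=> g0 x /asboolP[s Gs ->]; rewrite raddf_sum big_seq big1 // => c /Gs/g0 e.
by rewrite /= linearZ_LR e scaler0.
Qed.
End SpanTheory.

Definition fin_gen (R : pzRingType) (V : lmodType R) : Prop :=
  exists s : seq V, forall x, x \in lspan [set` s].

Section Free.
Variables (R : nzRingType) (T : choiceType) (V : lmodType R) (f : T -> V).
Lemma fglift_linear : linear (fglift f : {freeg T / R} -> V).
Proof.
move=> a x y.
have D : {morph (fglift f : {freeg T / R} -> V) : x y / x + y}.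
  have B := lift_is_additive f.
  have z0 : fglift f (0 : {freeg T / R}) = 0 by rewrite -(subrr 0) B subrr.
  by move=> u v; rewrite -[v in LHS]opprK B -[- v]add0r B z0 sub0r opprK.
have S (I : Type) (s : seq I) (F : I -> {freeg T / R}) :
    fglift f (\sum_(i <- s) F i) = \sum_(i <- s) fglift f (F i).
  apply: (big_morph _ D).
  by rewrite -(subrr 0) (lift_is_additive f) subrr.
rewrite D; congr (_ + _).
rewrite -[x in RHS]freeg_sumE [_ *: _]/(fgscale a x) /fgscale !S scaler_sumr.
by apply: eq_bigr => t _; rewrite !liftU scalerA.
Qed.
HB.instance Definition _ := GRing.isLinear.Build R {freeg T / R} V _
  (fglift f : {freeg T / R} -> V) fglift_linear.
End Free.

Section Frobenius.
Variables (p : nat) (R : comNzRingType).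

Section Tensor.
Variable M : lmodType R.
Let F : lmodType R := {freeg (R * M)%type / R}.
Let sym (r : R) (m : M) : F := << (r, m) >>.

(* The defining relations of R^1 (x)_R M for the bimodule R^1, whose left
   action is r.x = r * x and whose right action is x.a = x * a ^+ p; the left
   R-module structure of the tensor product is the last relation. *)
Inductive frob_rel : set F :=
| FrobDl x y m : frob_rel (sym (x + y) m - sym x m - sym y m)
| FrobDr x m n : frob_rel (sym x (m + n) - sym x m - sym x n)
| FrobBal x a m : frob_rel (sym (x * a ^+ p) m - sym x (a *: m))
| FrobZ r x m : frob_rel (sym (r * x) m - r *: sym x m).

Definition frob : lmodType R := quotm (lspan frob_rel).
Definition tens (r : R) (m : M) : frob := projm _ (sym r m).
End Tensor.

Section Map.
Variables (M N : lmodType R) (f : {linear M -> N}).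
Let g : {linear {freeg (R * M)%type / R} -> frob N} :=
  fglift (fun z : R * M => tens z.1 (f z.2)).

Lemma frob_map_rel x : x \in lspan (@frob_rel M) -> g x = 0.
Proof.
apply: lspan_lift0 => {}x.
have gE r m : g << (r, m) >> = tens r (f m) by rewrite /g/= liftU scale1r.
have t0 (y : {freeg (R * N)%type / R}) : frob_rel y -> projm (lspan (@frob_rel N)) y = 0.
  move=> ry; rewrite -[RHS](linear0 (projm (lspan (@frob_rel N)))).
  by apply/projm_eq; rewrite subr0; exact: mem_lspan.
case=> [r s m|r m n|r a m|r a m]; rewrite !linearB !gE.
- by rewrite -!linearB; exact/t0/FrobDl.
- by rewrite linearD -!linearB; exact/t0/FrobDr.
- by rewrite linearZ_LR -!linearB; exact/t0/FrobBal.
- rewrite [g (_ *: _)]linearZ_LR gE.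
  have := t0 _ (FrobZ r a (f m)); rewrite linearB => <-; congr (_ - _).
  exact: scalemE.
Qed.

Definition frob_map (t : frob M) : frob N := g (reprm t).

Lemma frob_map_linear : linear frob_map.
Proof. exact: quotm_lift_linear frob_map_rel. Qed.
HB.instance Definition _ :=
  GRing.isLinear.Build R (frob M) (frob N) _ frob_map frob_map_linear.

Lemma frob_mapE r m : frob_map (tens r m) = tens r (f m).
Proof. by rewrite /frob_map (quotm_liftE frob_map_rel) /g/= liftU scale1r. Qed.
End Map.

Fixpoint frob_iter (U : lmodType R) (e : nat) : lmodType R :=
  if e is e'.+1 then frob (frob_iter U e') else U.

Fixpoint frob_trans (U : lmodType R) (b : {linear U -> frob U}) (e : nat) :
    {linear frob_iter U e -> frob_iter U e.+1} :=
  if e is e'.+1 then frob_map (frob_trans b e') else b.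

End Frobenius.

(* [locm P N] is N_P, [locr P] is A_P, [locmax P] is its maximal ideal P A_P
   and [resfield P] is the residue field A_P / P A_P. *)
Section Localization.
Variables (A : comNzRingType) (P : prime_idealr A).

Definition denom : Type := {s : A | s \notin P}.
HB.instance Definition _ := [isSub of denom for (@sval _ _ : denom -> A)].
HB.instance Definition _ := [Choice of denom by <:].

Lemma denom1_subproof : 1 \notin P. Proof. by rewrite idealr1. Qed.
Definition denom1 : denom := exist (fun s => is_true (s \notin P)) 1 denom1_subproof.
Lemma denomM_subproof (s t : denom) : sval s * sval t \notin P.
Proof. by rewrite prime_idealrM negb_or (valP s) (valP t). Qed.
Definition denomM (s t : denom) : denom :=
  exist (fun s => is_true (s \notin P)) _ (denomM_subproof s t).

Section Module.
Variable N : lmodType A.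
Implicit Types (x y z : N) (s t u : denom).

Definition loc_eq (x y : N * denom) : bool :=
  `[< exists t : denom,
      sval t *: (sval y.2 *: x.1) = sval t *: (sval x.2 *: y.1) >].

Lemma loc_eq_refl : reflexive loc_eq.
Proof. by move=> x; apply/asboolP; exists denom1. Qed.
Lemma loc_eq_sym : ssrbool.symmetric loc_eq.
Proof. by move=> x y; apply/asboolP/asboolP=> -[t e]; exists t. Qed.
Lemma loc_eq_trans : transitive loc_eq.
Proof.
move=> [y b] [x a] [z c] /asboolP[t /= e] /asboolP[u /= e']; apply/asboolP => /=.
exists (denomM (denomM t u) b) => /=; rewrite !scalerA in e e' *.
have := congr1 (fun w => (sval u * sval c) *: w) e.
have := congr1 (fun w => (sval t * sval a) *: w) e'.
rewrite !scalerA => e2 e1.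
transitivity ((sval u * sval c * (sval t * sval b)) *: x).
  by congr (_ *: _); ring.
rewrite e1; transitivity ((sval t * sval a * (sval u * sval c)) *: y).
  by congr (_ *: _); ring.
by rewrite e2; congr (_ *: _); ring.
Qed.

Canonical loc_equiv := EquivRel loc_eq loc_eq_refl loc_eq_sym loc_eq_trans.
Canonical loc_enc := defaultEncModRel loc_eq.
Definition locm : Type := {eq_quot loc_eq}.
HB.instance Definition _ := Choice.on locm.

Definition lfrac (x : N) (s : denom) : locm := \pi_({eq_quot loc_eq}) (x, s).
Definition num (w : locm) : N := (repr (w : {eq_quot loc_eq})).1.
Definition den (w : locm) : denom := (repr (w : {eq_quot loc_eq})).2.

Lemma fracK w : lfrac (num w) (den w) = w.
Proof. by rewrite /lfrac /num /den -surjective_pairing; exact: reprK. Qed.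

Lemma fracP w : exists x s, w = lfrac x s.
Proof. by exists (num w), (den w); rewrite fracK. Qed.

Lemma frac_eq x s y t : lfrac x s = lfrac y t <->
  exists u, sval u *: (sval t *: x) = sval u *: (sval s *: y).
Proof.
split=> [/eqmodP/asboolP//|e].
by apply/eqmodP; apply/asboolP.
Qed.

Lemma numden x s : exists u,
  (sval u * sval s) *: num (lfrac x s) = (sval u * sval (den (lfrac x s))) *: x.
Proof.
by have /frac_eq[u] := fracK (lfrac x s); rewrite !scalerA; exists u.
Qed.

Definition loc_add w1 w2 :=
  lfrac (sval (den w2) *: num w1 + sval (den w1) *: num w2)
       (denomM (den w1) (den w2)).
Definition loc_opp w := lfrac (- num w) (den w).
Definition loc_zero := lfrac 0 denom1.

Lemma loc_addE x s y t :
  loc_add (lfrac x s) (lfrac y t) = lfrac (sval t *: x + sval s *: y) (denomM s t).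
Proof.
have [u e] := numden x s; have [v e'] := numden y t.
apply/frac_eq; exists (denomM u v); rewrite /= !scalerDr !scalerA.
set a := num _ in e *; set b := num _ in e' *.
set c := den _ in e *; set d := den _ in e' *.
have := congr1 (fun w => (sval v * sval t * sval d) *: w) e.
have := congr1 (fun w => (sval u * sval s * sval c) *: w) e'.
rewrite !scalerA => e2 e1; congr (_ + _).
  by transitivity ((sval v * sval t * sval d * (sval u * sval s)) *: a);
    [congr (_ *: _); ring | rewrite e1; congr (_ *: _); ring].
by transitivity ((sval u * sval s * sval c * (sval v * sval t)) *: b);
  [congr (_ *: _); ring | rewrite e2; congr (_ *: _); ring].
Qed.

Lemma loc_oppE x s : loc_opp (lfrac x s) = lfrac (- x) s.
Proof.
have [u e] := numden x s; apply/frac_eq; exists u.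
by rewrite !scalerN !scalerA e.
Qed.

Let loc_addA : associative loc_add.
Proof.
move=> a b c; have [x [s ->]] := fracP a; have [y [t ->]] := fracP b; have [z [u ->]] := fracP c; rewrite !loc_addE.
apply/frac_eq; exists denom1; rewrite /= !scalerDr !scalerA !addrA.
by congr (_ *: _ + _ *: _ + _ *: _); ring.
Qed.
Let loc_addC : commutative loc_add.
Proof.
move=> a b; have [x [s ->]] := fracP a; have [y [t ->]] := fracP b; rewrite !loc_addE addrC.
by apply/frac_eq; exists denom1; rewrite /= mulrC.
Qed.
Let loc_add0 : left_id loc_zero loc_add.
Proof.
move=> a; have [x [s ->]] := fracP a; rewrite loc_addE scaler0 add0r scale1r.
by apply/frac_eq; exists denom1; rewrite /= mul1r.
Qed.
Let loc_addN : left_inverse loc_zero loc_opp loc_add.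
Proof.
move=> a; have [x [s ->]] := fracP a; rewrite loc_oppE loc_addE scalerN addNr.
by apply/frac_eq; exists denom1; rewrite !scaler0.
Qed.
HB.instance Definition _ := GRing.isZmodule.Build locm
  loc_addA loc_addC loc_add0 loc_addN.

Lemma fracD x s y t :
  lfrac x s + lfrac y t = lfrac (sval t *: x + sval s *: y) (denomM s t).
Proof. exact: loc_addE. Qed.
End Module.

Definition locr : Type := locm A^o.
HB.instance Definition _ := GRing.Zmodule.on locr.

Definition fracr (a : A) (s : denom) : locr := @lfrac A^o a s.

Lemma fracrP (w : locr) : exists a s, w = fracr a s.
Proof. exact: (@fracP A^o). Qed.

Lemma fracr_eq a s b t : fracr a s = fracr b t <->
  exists u : denom, sval u * (sval t * a) = sval u * (sval s * b).
Proof. exact: (@frac_eq A^o). Qed.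

Lemma fracrD a s b t :
  fracr a s + fracr b t = fracr (sval t * a + sval s * b) (denomM s t).
Proof. exact: (@fracD A^o). Qed.

Section Scale.
Variable N : lmodType A.

Definition loc_scale (a : locr) (w : locm N) : locm N :=
  lfrac ((num a : A) *: num w) (denomM (den a) (den w)).

Lemma loc_scaleE a s (x : N) t :
  loc_scale (fracr a s) (lfrac x t) = lfrac (a *: x) (denomM s t).
Proof.
have [u e] := @numden A^o a s; have [v e'] := numden x t.
apply/frac_eq; exists (denomM u v); rewrite /= !scalerA.
set b := num _ in e *; set y := num _ in e' *.
set c := den _ in e *; set d := den _ in e' *.
have {}e : sval u * sval s * (b : A) = sval u * sval c * a by [].
transitivity ((sval u * sval s * (b : A)) *: ((sval v * sval t) *: y)).
  by rewrite scalerA; congr (_ *: _); rewrite -/b -/c; ring.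
by rewrite e e' scalerA; congr (_ *: _); ring.
Qed.
End Scale.

Let loc_mul : locr -> locr -> locr := @loc_scale A^o.
Let loc_one : locr := fracr 1 denom1.

Let loc_mulE a s b t :
  loc_mul (fracr a s) (fracr b t) = fracr (a * b) (denomM s t).
Proof. exact: (@loc_scaleE A^o). Qed.

Section ScaleTheory.
Variable N : lmodType A.

Lemma loc_scaleA (a b : locr) (w : locm N) :
  loc_scale a (loc_scale b w) = loc_scale (loc_mul a b) w.
Proof.
have [x [s ->]] := fracrP a; have [y [t ->]] := fracrP b.
have [z [u ->]] := fracP w.
rewrite loc_mulE (loc_scaleE y) (loc_scaleE x) (loc_scaleE (x * y)).
apply/frac_eq; exists denom1; rewrite /= !scalerA; congr (_ *: _); ring.
Qed.
Lemma loc_scale1 : left_id loc_one (@loc_scale N).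
Proof.
move=> w; have [z [u ->]] := fracP w; rewrite loc_scaleE scale1r.
by apply/frac_eq; exists denom1; rewrite /= mul1r.
Qed.
Lemma loc_scaleDr : right_distributive (@loc_scale N) +%R.
Proof.
move=> a v w; have [x [s ->]] := fracrP a; have [y [t ->]] := fracP v.
have [z [u ->]] := fracP w; rewrite fracD.
rewrite (loc_scaleE x s y) (loc_scaleE x s z) (loc_scaleE x s) fracD.
apply/frac_eq; exists denom1; rewrite /= !scalerDr !scalerA.
by congr (_ *: _ + _ *: _); ring.
Qed.
Lemma loc_scaleDl (w : locm N) : {morph (@loc_scale N)^~ w : a b / a + b}.
Proof.
move=> a b; have [x [s ->]] := fracrP a; have [y [t ->]] := fracrP b.
have [z [u ->]] := fracP w; rewrite fracrD.
rewrite (loc_scaleE x s z) (loc_scaleE y t z) loc_scaleE fracD.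
apply/frac_eq; exists denom1; rewrite /= !scalerDr !scalerA -!scalerDl.
congr (_ *: _); ring.
Qed.
End ScaleTheory.

Let loc_mulC : commutative loc_mul.
Proof.
move=> a b; have [x [s ->]] := fracrP a; have [y [t ->]] := fracrP b.
rewrite !loc_mulE; apply/fracr_eq; exists denom1 => /=; ring.
Qed.
Let loc_mulDl : left_distributive loc_mul +%R.
Proof. by move=> a b c; exact: loc_scaleDl. Qed.
Let loc_one_neq0 : loc_one != 0.
Proof.
apply/eqP => /(@fracr_eq 1 denom1 0 denom1)[u]; rewrite /= !mulr1 !mulr0 => u0.
by have := valP u; rewrite /= u0 idealr0.
Qed.
HB.instance Definition _ := GRing.Zmodule_isComNzRing.Build locr
  (@loc_scaleA A^o) loc_mulC (@loc_scale1 A^o) loc_mulDl loc_one_neq0.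

Lemma fracrM a s b t : fracr a s * fracr b t = fracr (a * b) (denomM s t).
Proof. exact: loc_mulE. Qed.

HB.instance Definition _ (N : lmodType A) :=
  GRing.Zmodule_isLmodule.Build locr (locm N)
    (@loc_scaleA N) (@loc_scale1 N) (@loc_scaleDr N) (@loc_scaleDl N).

Definition locmax : {pred locr} := fun x =>
  `[< exists a s, a \in P /\ x = fracr a s >].

Lemma locmaxE a s : (fracr a s \in locmax) = (a \in P).
Proof.
apply/asboolP/idP => [[b [t [bP /fracr_eq[u e]]]]|aP]; last by exists a, s.
have : sval u * (sval s * b) \in P by rewrite !idealMr.
rewrite -e !prime_idealrM; move: (valP u) (valP t) => /=.
by do 2!move=> /negPf->.
Qed.

Lemma locmax_closed : idealr_closed locmax.
Proof.
split.
- by rewrite [0]/(fracr 0 denom1) locmaxE idealr0.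
- by rewrite [1]/(fracr 1 denom1) locmaxE idealr1.
move=> a u v; have [x [s ->]] := fracrP a; have [y [t ->]] := fracrP u.
have [z [w ->]] := fracrP v; rewrite (locmaxE y) (locmaxE z) => uP vP.
by rewrite fracrM fracrD locmaxE rpredD // ?idealMr.
Qed.
HB.instance Definition _ := isIdealr.Build locr locmax locmax_closed.

Definition resfield : Type := {ideal_quot locmax}.
HB.instance Definition _ := GRing.ComNzRing.on resfield.
End Localization.
Arguments locmax {A} P _.

Section Hom.
Variables (R : comNzRingType) (U V : lmodType R).

Definition hom_pred : {pred (U -> V)} := fun f => `[< linear f >].
Lemma hom_closed : submod_closed hom_pred.
Proof.
split; first by apply/asboolP => a x y; rewrite /= scaler0 addr0.
move=> a f g /asboolP lf /asboolP lg; apply/asboolP => b x y.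
rewrite !fctE lf lg !scalerDr !scalerA [a * b]mulrC.
by rewrite addrACA.
Qed.
HB.instance Definition _ := GRing.isSubmodClosed.Build R (U -> V) hom_pred hom_closed.

Definition hom : lmodType R := subm hom_pred.
Definition hom_fun (f : hom) : U -> V := \val f.
Lemma hom_fun_linear (f : hom) : linear (hom_fun f).
Proof. exact/asboolP/(valP f). Qed.
HB.instance Definition _ (f : hom) :=
  GRing.isLinear.Build R U V _ (hom_fun f) (hom_fun_linear f).
Lemma hom_funP a (f g : hom) x :
  hom_fun (a *: f + g) x = a *: hom_fun f x + hom_fun g x.
Proof. by []. Qed.
Lemma hom_funZ a (f : hom) x : hom_fun (a *: f) x = a *: hom_fun f x.
Proof. by []. Qed.
Lemma hom_funD (f : hom) x y : hom_fun f (x + y) = hom_fun f x + hom_fun f y.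
Proof. exact: linearD. Qed.
Lemma hom_ext (f g : hom) : hom_fun f =1 hom_fun g -> f = g.
Proof. by move=> fg; apply/val_inj/funext. Qed.
Definition hom_of (f : U -> V) (lf : linear f) : hom :=
  subm_in (S := hom_pred) (asboolT lf).
End Hom.

Section Ext.
Variable R : comNzRingType.

Definition freemod (K : lmodType R) : lmodType R := {freeg K / R}.
Definition aug (K : lmodType R) : {linear freemod K -> K} :=
  fglift (id : K -> K) : {freeg K / R} -> K.

Section Kernel.
Variables (V W : lmodType R) (f : {linear V -> W}).
Definition ker_pred : {pred V} := fun x => f x == 0.
Lemma ker_closed : submod_closed ker_pred.
Proof.
split; first by rewrite unfold_in linear0.
move=> a x y /eqP fx /eqP fy; apply/eqP.
by rewrite linearP fx fy scaler0 addr0.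
Qed.
HB.instance Definition _ := GRing.isSubmodClosed.Build R V ker_pred ker_closed.
Lemma ker_val (x : subm ker_pred) : f (\val x) = 0.
Proof. exact/eqP/(valP x). Qed.
End Kernel.

Lemma ker0_closed (V : lmodType R) : submod_closed (fun x : V => x == 0).
Proof.
split; first exact/eqP.
by move=> a x y /eqP-> /eqP->; apply/eqP; rewrite scaler0 addr0.
Qed.

(* The standard free resolution  ... -> F_1 -> F_0 -> K -> 0  of K: F_i is free
   on the underlying set of the i-th syzygy module. *)
Fixpoint syz (K : lmodType R) (i : nat) : lmodType R :=
  if i is j.+1 then subm (ker_pred (aug (syz K j))) else K.
Definition res (K : lmodType R) (i : nat) : lmodType R := freemod (syz K i).
Definition res_diff (K : lmodType R) (i : nat) (x : res K i.+1) : res K i :=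
  \val (aug (syz K i.+1) x).

Lemma res_diff_linear K i : linear (@res_diff K i).
Proof. by move=> a x y; rewrite /res_diff linearP linearP. Qed.
HB.instance Definition _ K i :=
  GRing.isLinear.Build R (res K i.+1) (res K i) _ (@res_diff K i) (@res_diff_linear K i).

Section Cohomology.
Variables (K N : lmodType R).

Definition cocycle (i : nat) : {pred hom (res K i) N} := fun f =>
  `[< forall x, hom_fun f (res_diff x) = 0 >].
Lemma cocycle_closed i : submod_closed (@cocycle i).
Proof.
split; first by apply/asboolP.
move=> a f g /asboolP zf /asboolP zg; apply/asboolP => x.
by rewrite hom_funP zf zg scaler0 addr0.
Qed.
HB.instance Definition _ i :=
  GRing.isSubmodClosed.Build R (hom (res K i) N) (@cocycle i) (@cocycle_closed i).

Definition coboundary (i : nat) : {pred subm (@cocycle i)} :=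
  match i with
  | 0 => fun f => f == 0
  | j.+1 => fun f => `[< exists g : hom (res K j) N,
      forall x, hom_fun (\val f) x = hom_fun g (res_diff x) >]
  end.
Lemma coboundary_closed i : submod_closed (@coboundary i).
Proof.
case: i => [|i].
  exact: (ker0_closed (subm (@cocycle 0))).
split; first by apply/asboolP; exists 0.
move=> a f g /asboolP[f' ef] /asboolP[g' eg]; apply/asboolP.
exists (a *: f' + g') => x; rewrite hom_funP -ef -eg.
exact: (hom_funP a (\val f) (\val g)).
Qed.
HB.instance Definition _ i :=
  GRing.isSubmodClosed.Build R (subm (@cocycle i)) (@coboundary i) (@coboundary_closed i).

Definition Ext (i : nat) : lmodType R := quotm (@coboundary i).
End Cohomology.
End Ext.

(* An element annihilating K annihilates Ext^i(K, N); this is what makes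
   Ext^i(k(p), _) a vector space over k(p) below. *)
Section ExtAnnihilator.
Variable R : comNzRingType.

Lemma free_ext (K V : lmodType R) (f g : {linear freemod K -> V}) :
  (forall k, f << k >> = g << k >>) -> f =1 g.
Proof.
move=> fg x; rewrite -[x]freeg_sumE !raddf_sum; apply: eq_bigr => k _ /=.
have -> : << coeff k x *g k >> = coeff k x *: << k >> :> freemod K.
  by apply/eqP/freeg_eqP => l; rewrite coeffZ !coeffU mulrA mulr1.
by rewrite 2!linearZ_LR fg.
Qed.

Variables (K N : lmodType R) (a : R).
Hypothesis aK : forall k : K, a *: k = 0.

Lemma res_lift i (f : {linear res K i -> res K i}) :
  (forall x, aug (syz K i) (f x) = 0) ->
  exists h : {linear res K i -> res K i.+1}, forall x, res_diff (h x) = f x.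
Proof.
move=> f0; have s x : f x \in ker_pred (aug (syz K i)) by apply/eqP.
pose h : {linear res K i -> res K i.+1} :=
  fglift (fun k : syz K i => << (subm_in (s << k >>) : syz K i.+1) >> : res K i.+1).
exists h; apply: (free_ext (f := @res_diff R K i \o h)) => k /=.
by rewrite /res_diff /h /= liftU scale1r liftU scale1r.
Qed.

Let Q i (h : {linear res K i -> res K i.+1}) :=
  forall y : res K i.+1, res_diff (h (res_diff y)) = a *: res_diff y.

Lemma res_diffK i (y : res K i.+2) : res_diff (res_diff y) = 0.
Proof.
exact: (congr1 (fun z : syz K i.+1 => \val z) (ker_val (aug (syz K i.+2) y))).
Qed.

Lemma res_step i h : @Q i h ->
  exists h' : {linear res K i.+1 -> res K i.+2},
    forall x, res_diff (h' x) = a *: x - h (res_diff x).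
Proof.
move=> Qh.
have fl : linear (fun x : res K i.+1 => a *: x - h (res_diff x)).
  move=> b x y; rewrite scalerDr !scalerA mulrC -scalerA linearP linearP opprD.
  by rewrite scalerBr addrACA.
pose fL := GRing.isLinear.Build R (res K i.+1) (res K i.+1) _ _ fl.
pose f : {linear res K i.+1 -> res K i.+1} := HB.pack (fun x : res K i.+1 => a *: x - h (res_diff x)) fL.
apply: (res_lift (f := f)) => x; apply/val_inj.
have -> : \val (0 : syz K i.+1) = 0 by [].
rewrite -[LHS]/(res_diff (a *: x - h (res_diff x))) linearB linearZ_LR /= Qh.
by rewrite subrr.
Qed.

Lemma res_zero : exists h : {linear res K 0 -> res K 1},
  forall x, res_diff (h x) = a *: x.
Proof.
have fl : linear (fun x : res K 0 => a *: x).
  by move=> b x y; rewrite scalerDr !scalerA mulrC.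
pose fL := GRing.isLinear.Build R (res K 0) (res K 0) _ _ fl.
pose f : {linear res K 0 -> res K 0} := HB.pack (fun x : res K 0 => a *: x) fL.
by apply: (res_lift (f := f)) => x; rewrite /= linearZ_LR; exact: aK.
Qed.

Lemma res_homotopy i : exists h, @Q i h.
Proof.
elim: i => [|i [h Qh]].
  by have [h e] := res_zero; exists h => y; rewrite e.
have [h' e] := res_step Qh; exists h' => y.
by rewrite e res_diffK linear0 subr0.
Qed.

Lemma Ext_ann i (x : Ext K N i) : a *: x = 0.
Proof.
rewrite -[x]projmK -linearZ_LR -[RHS](linear0 (projm _)); apply/projm_eq.
rewrite subr0; set f := reprm x.
have zf : forall y, hom_fun (\val f) (res_diff y) = 0 by exact/asboolP/(valP f).
have fZ y : a *: hom_fun (\val f) y = hom_fun (\val f) (a *: y).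
  by rewrite linearZ_LR.
case: i x @f zf fZ => [|i] x f zf fZ.
  have [h e] := res_zero; apply/eqP/val_inj; rewrite submZ.
  by apply: hom_ext => y; rewrite hom_funZ fZ -e zf.
have [h Qh] := res_homotopy i; have [h' e] := res_step Qh.
have gl : linear (fun y => hom_fun (\val f) (h y)).
  by move=> b y z; rewrite linearP linearP.
apply/asboolP; exists (hom_of gl) => y; rewrite submZ hom_funZ fZ.
have ey : a *: y = res_diff (h' y) + h (res_diff y) by rewrite e subrK.
by rewrite ey hom_funD zf; exact: add0r.
Qed.
End ExtAnnihilator.

Section Bass.
Variables (A : comNzRingType) (P : prime_idealr A).

Definition residue : {rmorphism locr P -> resfield P} :=
  \pi_({ideal_quot (locmax P)}).
Let rscale (a : locr P) (x : resfield P) : resfield P := residue a * x.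
Let rscaleA a b x : rscale a (rscale b x) = rscale (a * b) x.
Proof. by rewrite /rscale rmorphM mulrA. Qed.
Let rscale1 : left_id 1 rscale.
Proof. by move=> x; rewrite /rscale rmorph1 mul1r. Qed.
Let rscaleDr : right_distributive rscale +%R.
Proof. by move=> a x y; rewrite /rscale mulrDr. Qed.
Let rscaleDl x : {morph rscale^~ x : a b / a + b}.
Proof. by move=> a b; rewrite /rscale rmorphD mulrDl. Qed.
HB.instance Definition _ := GRing.Zmodule_isLmodule.Build (locr P) (resfield P)
  rscaleA rscale1 rscaleDr rscaleDl.

Definition rrepr (k : resfield P) : locr P := repr (k : {ideal_quot (locmax P)}).
Lemma rreprK k : residue (rrepr k) = k. Proof. exact: reprK. Qed.

Lemma residue_eq0 (a : locr P) : residue a = 0 <-> a \in locmax P.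
Proof.
rewrite -[residue a]/(\pi_({ideal_quot (locmax P)}) a).
have := Quotient.idealrBE (locmax P) a 0; rewrite subr0 => ->.
by rewrite (rmorph0 residue : \pi 0 = _); split => [->|/eqP].
Qed.

Variables (N : lmodType A) (i : nat).

(* Ext^i_{A_P}(k(P), N_P), as a vector space over k(P). *)
Definition bass_ext : Type := Ext (resfield P : lmodType (locr P)) (locm P N) i.
HB.instance Definition _ := GRing.Zmodule.on bass_ext.

Let E : lmodType (locr P) := Ext (resfield P : lmodType (locr P)) (locm P N) i.

Lemma bass_scale_wd (a b : locr P) (x : E) :
  residue a = residue b -> a *: x = b *: x.
Proof.
move=> ab; apply/eqP; rewrite -subr_eq0 -scalerBl; apply/eqP/Ext_ann => k.
by rewrite [LHS]/(residue (a - b) * k) rmorphB ab subrr; exact: mul0r.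
Qed.

Definition bass_scale (k : resfield P) (x : bass_ext) : bass_ext :=
  rrepr k *: (x : E).

Let bass_scaleA k l x : bass_scale k (bass_scale l x) = bass_scale (k * l) x.
Proof.
rewrite /bass_scale scalerA; apply: bass_scale_wd.
by rewrite rmorphM !rreprK.
Qed.
Let bass_scale1 : left_id 1 bass_scale.
Proof.
move=> x; rewrite -[RHS](scale1r (x : E)); apply: bass_scale_wd.
by rewrite rreprK rmorph1.
Qed.
Let bass_scaleDr : right_distributive bass_scale +%R.
Proof. by move=> k x y; exact: (scalerDr (rrepr k) (x : E) (y : E)). Qed.
Let bass_scaleDl x : {morph bass_scale^~ x : k l / k + l}.
Proof.
move=> k l; rewrite -[RHS](scalerDl (x : E)); apply: bass_scale_wd.
by rewrite rmorphD !rreprK.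
Qed.
HB.instance Definition _ := GRing.Zmodule_isLmodule.Build (resfield P) bass_ext
  bass_scaleA bass_scale1 bass_scaleDr bass_scaleDl.
End Bass.

(* [I] is the cardinality of a basis of V, i.e. V is isomorphic to k^(I). *)
Definition has_dim (k : nzRingType) (V : lmodType k) (I : choiceType) : Prop :=
  exists b : I -> V, bijective (fglift b : {freeg I / k} -> V).

(* Bass numbers may be infinite, hence the cardinal-valued formulation:
   mu_i(P, N) = |I|. *)
Definition bass_number (A : comNzRingType) (P : prime_idealr A) (i : nat)
    (N : lmodType A) (I : choiceType) : Prop :=
  has_dim (bass_ext P N i) I.

Section Dimension.
Variable A : comNzRingType.

(* sup L, with sup set0 = -oo. *)
Definition supn (L : set nat) : \bar nat :=
  if `[< L = set0 >] then -oo%E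
  else if `[< exists d, ubound L d >] then
    (xget 0%N [set d | L d /\ ubound L d])%:E
  else +oo%E.

Definition infn (L : set nat) : \bar nat :=
  if `[< L = set0 >] then +oo%E
  else (xget 0%N [set d | L d /\ lbound L d])%:E.

(* The lengths of the chains of primes in X; the sup is -oo if X is empty, so
   that [supp_dim 0 = -oo] below. *)
Definition prime_chain (X : prime_idealr A -> Prop) : set nat := [set d |
  exists c : nat -> prime_idealr A,
    (forall i, (i <= d)%N -> X (c i)) /\
    (forall i, (i < d)%N -> {subset c i <= c i.+1} /\
                            exists2 a, a \in c i.+1 & a \notin c i)].

Definition krull_dim : \bar nat := supn (prime_chain (fun=> True)).

Definition supp (N : lmodType A) (P : prime_idealr A) : Prop :=
  exists x : locm P N, x != 0.

Definition supp_dim (N : lmodType A) : \bar nat := supn (prime_chain (supp N)).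

Definition Ass (N : lmodType A) (P : prime_idealr A) : Prop :=
  exists x : N, forall a, (a \in P) = (a *: x == 0).

Definition injective_module (I : lmodType A) : Prop :=
  forall (V W : lmodType A) (j : {linear V -> W}) (f : {linear V -> I}),
    injective j -> exists g : {linear W -> I}, forall x, g (j x) = f x.

Definition injective_resolution (N : lmodType A) (d : nat) : Prop :=
  exists (I : nat -> lmodType A) (eps : {linear N -> I 0})
         (delta : forall i, {linear I i -> I i.+1}),
  [/\ forall i, injective_module (I i),
      injective eps,
      forall x, delta 0 x = 0 <-> exists y, x = eps y,
      forall i x, delta i.+1 x = 0 <-> exists y, x = delta i y &
      forall i, (d < i)%N -> forall x : I i, x = 0].

(* The zero module gets the value -oo, as for [supp_dim]. *)
Definition injdim (N : lmodType A) : \bar nat :=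
  if `[< forall x : N, x = 0 >] then -oo%E else infn (injective_resolution N).

Definition noetherian : Prop := forall I : submodClosed A^o,
  exists s : seq A^o, forall x, (x \in I) = (x \in lspan [set` s]).

(* The first clause makes A local with maximal ideal m. *)
Definition regular_local : Prop := exists m : idealr A,
  [/\ forall x, x \notin m -> exists y, x * y = 1,
      noetherian &
      exists s : seq A^o, krull_dim = (size s)%:E /\
        forall x, (x \in m) = (x \in lspan [set` s])].
End Dimension.

Definition regular_ring (A : comNzRingType) : Prop :=
  noetherian A /\ forall P : prime_idealr A, regular_local (locr P).

Section Graded.
Variables (A : comNzRingType) (n : nat).
Local Notation R := {mpoly A[n]}.
Local Notation deg := {ffun 'I_n -> int}.

(* R_u; it is 0 when u is not in N^n. *)
Definition mdegree (u : deg) : set R :=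
  [set r | forall m, m \in msupp r -> forall j, (m j)%:Z = u j].

Record zgrading (M : lmodType R) := ZGrading {
  zcomp :> deg -> set M;
  zcomp0 : forall u, zcomp u 0;
  zcompB : forall u x y, zcomp u x -> zcomp u y -> zcomp u (x - y);
  zcompZ : forall u v r x, mdegree u r -> zcomp v x -> zcomp (u + v) (r *: x);
  zcomp_sum : forall x, exists (s : seq deg) (f : deg -> M),
    (forall u, zcomp u (f u)) /\ x = \sum_(u <- s) f u;
  zcomp_direct : forall (s : seq deg) (f : deg -> M), uniq s ->
    (forall u, zcomp u (f u)) -> \sum_(u <- s) f u = 0 ->
    forall u, u \in s -> f u = 0
}.

(* Restriction of scalars to A; used for the A-modules M_u. *)
Definition scalarA (M : lmodType R) : Type := M.
Section ScalarA.
Variable M : lmodType R.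
HB.instance Definition _ := GRing.Zmodule.on (scalarA M).
Let scaleA (a : A) (x : scalarA M) : scalarA M := a%:MP_[n] *: (x : M).
Let scaleAA a b x : scaleA a (scaleA b x) = scaleA (a * b) x.
Proof. by rewrite /scaleA scalerA -rmorphM. Qed.
Let scaleA1 : left_id 1 scaleA.
Proof. by move=> x; rewrite /scaleA rmorph1 scale1r. Qed.
Let scaleADr : right_distributive scaleA +%R.
Proof. by move=> a x y; rewrite /scaleA scalerDr. Qed.
Let scaleADl x : {morph scaleA^~ x : a b / a + b}.
Proof. by move=> a b; rewrite /scaleA rmorphD scalerDl. Qed.
HB.instance Definition _ := GRing.Zmodule_isLmodule.Build A (scalarA M)
  scaleAA scaleA1 scaleADr scaleADl.
End ScalarA.

Section Component.
Variables (M : lmodType R) (g : zgrading M) (u : deg).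
Definition comp_pred : {pred scalarA M} := fun x => `[< g u x >].
Lemma comp_closed : submod_closed comp_pred.
Proof.
split; first by apply/asboolP; exact: zcomp0.
move=> a x y /asboolP gx /asboolP gy; apply/asboolP.
have ga : g u (a%:MP_[n] *: (x : M)).
  rewrite -[u]add0r; apply: zcompZ => // m.
  rewrite msuppC; case: ifP => // _; rewrite inE => /eqP -> j.
  by rewrite mnm0E ffunE.
rewrite -[a *: x + y]/(a%:MP_[n] *: (x : M) + (y : M)) -[y in X in g u X]opprK.
by apply: zcompB => //; rewrite -sub0r; apply: zcompB => //; exact: zcomp0.
Qed.
HB.instance Definition _ :=
  GRing.isSubmodClosed.Build A (scalarA M) comp_pred comp_closed.
Definition component : lmodType A := subm comp_pred.
End Component.

Variable p : nat.

(* The grading of F(M), by deg (r (x) m) = deg r + p deg m. *)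
Definition frob_deg (M : lmodType R) (g : deg -> set M) (w : deg) :
    set (frob p M) := [set t |
  exists2 s : seq (R * M),
    (forall c, c \in s ->
       exists u v, [/\ mdegree u c.1, g v c.2 & w = u + v *+ p]) &
    t = \sum_(c <- s) tens p c.1 c.2].

Fixpoint frob_iter_deg (U : lmodType R) (g : deg -> set U) (e : nat) :
    deg -> set (frob_iter p U e) :=
  match e return deg -> set (frob_iter p U e) with
  | 0 => g
  | e'.+1 => frob_deg (@frob_iter_deg U g e')
  end.
End Graded.
Arguments frob_iter_deg {A n p U} g e _ _.

(* (M, phi) satisfies the universal property of the direct limit of (V, f). *)
Definition direct_limit (R : pzRingType) (V : nat -> lmodType R)
    (f : forall e, {linear V e -> V e.+1}) (M : lmodType R)
    (phi : forall e, {linear V e -> M}) : Prop :=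
  (forall e x, phi e.+1 (f e x) = phi e x) /\
  forall (N : lmodType R) (psi : forall e, {linear V e -> N}),
    (forall e x, psi e.+1 (f e x) = psi e x) ->
    exists h : {linear M -> N},
      (forall e x, h (phi e x) = psi e x) /\
      forall h' : {linear M -> N}, (forall e x, h' (phi e x) = psi e x) ->
        h' =1 h.

(* The F-module (M, theta) with the grading gM is the direct limit of
   U -> F(U) -> F^2(U) -> ... for a degree preserving beta : U -> F(U) with U
   finitely generated graded. The fourth clause says that theta is induced by
   the shift of the direct system, phi e.+1 being defined on
   F^e.+1(U) = F(F^e(U)); the last one that gM is the induced grading. *)
Definition graded_F_finite (A : comNzRingType) (n p : nat)
    (M : lmodType {mpoly A[n]}) (theta : {linear M -> frob p M})
    (gM : zgrading M) : Prop :=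
  exists (U : lmodType {mpoly A[n]}) (gU : zgrading U)
         (beta : {linear U -> frob p U})
         (phi : forall e, {linear frob_iter p U e -> M}),
  [/\ fin_gen U,
      forall u x, gU u x -> frob_deg gU u (beta x),
      direct_limit (frob_trans beta) phi,
      forall e (x : frob_iter p U e.+1), theta (phi e.+1 x) = frob_map (phi e) x &
      forall u x, gM u x <->
        exists e y, frob_iter_deg gU e u y /\ x = phi e y].

Definition orthant (n : nat) (U : {set 'I_n}) : set {ffun 'I_n -> int} :=
  [set u | forall i, if i \in U then 0 <= u i else u i <= -1].

(* Main.v *)
Require Import Defs.
From HB Require Import structures.
From mathcomp Require Import all_boot all_order all_algebra.
From mathcomp Require Import ring_quotient zify.
From mathcomp.multinomials Require Import freeg mpoly.
From mathcomp Require Import boolp classical_sets constructive_ereal.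
Set Implicit Arguments.
Unset Strict Implicit.
Unset Printing Implicit Defensive.
Import GRing.Theory.
Local Open Scope ring_scope.
Local Open Scope classical_set_scope.

(** Why the theorem holds.  Every invariant in the statement only depends on the
    isomorphism class of an A-module, so it is enough that the components M_u,
    for u in one orthant B(U), are pairwise isomorphic over A.

    Divide a degree by p in each coordinate: w = r + p q with 0 <= r_j < p.
    In F(M), generated by the r (x) m, the scalar X_j^p moves through the tensor
    sign as X_j, so that every element of degree w can be written with first
    factors in A X^r and second factors in M_q.  In fact
    the map a (x) m |-> a X^r (x) m is an A-linear isomorphism from F_A(M_q), the
    Frobenius functor of the ring A itself, onto the component F(M)_w
    ([graded_frob_iso]).  As M is the graded direct limit of the F^e of a graded
    module, the structure isomorphism M -> F(M) identifies the gradings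
    ([theta_deg], [theta_deg_inv]), and therefore M_w is isomorphic to F_A(M_q)
    ([component_frob]).

    Coordinatewise floor division by p maps an orthant into itself and, when
    repeated, ends in the only degree of the orthant whose coordinates are all
    0 or -1.  Since F_A is a functor, isomorphisms climb back up these steps,
    and any two components in the orthant are isomorphic
    ([component_orthant]).

    The injectivity of F_A(M_q) -> F(M)_w is the delicate point.  A retraction
    has to be defined on all of F(M), including inhomogeneous tensors, and it is
    only A-linear; it is obtained from an R-linear map to the coinduced module
    Hom_A(R, F_A(M_q)) by evaluation at 1 ([graded_retraction]).

    For the Bass numbers, isomorphic modules have isomorphic Ext over the residue
    field ([bass_ext_liniso]), so a basis for one component serves for all;
    a basis exists by Zorn's lemma ([exists_basis]). *)

(** * Linear isomorphisms and the invariants they preserve *)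

Definition lin_of (R : pzRingType) (V W : lmodType R) (f : V -> W)
    (lf : linear f) : {linear V -> W} :=
  HB.pack f (GRing.isLinear.Build R V W _ f lf).

(** Linearity is recorded in both directions, so that a functor can be applied to
    each of them. *)
Definition liniso (R : pzRingType) (V W : lmodType R) : Prop :=
  exists (f : {linear V -> W}) (g : {linear W -> V}), cancel f g /\ cancel g f.

Lemma liniso_refl (R : pzRingType) (V : lmodType R) : liniso V V.
Proof.
have idl : linear (id : V -> V) by [].
by exists (lin_of idl), (lin_of idl).
Qed.

Lemma liniso_sym (R : pzRingType) (V W : lmodType R) :
  liniso V W -> liniso W V.
Proof. by move=> [f [g [fK gK]]]; exists g, f. Qed.

Lemma liniso_trans (R : pzRingType) (V W X : lmodType R) :
  liniso V W -> liniso W X -> liniso V X.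
Proof.
move=> [f [g [fK gK]]] [f' [g' [fK' gK']]]; exists (f' \o f), (g \o g').
by split; [exact: can_comp|exact: can_comp].
Qed.

Lemma liniso_bij (R : pzRingType) (V W : lmodType R) (f : {linear V -> W}) :
  bijective f -> liniso V W.
Proof.
move=> [g fK gK].
have gl : linear g.
  by move=> a x y; apply: (can_inj fK); rewrite linearP !gK.
by exists f, (lin_of gl).
Qed.

Section IsoInvariants.
Variables (A : comNzRingType) (N N' : lmodType A).
Hypothesis NN' : liniso N N'.

Lemma Ass_sub_liniso P : Ass N P -> Ass N' P.
Proof.
move: NN' => [f [g [fK gK]]] [x xP]; exists (f x) => a.
by rewrite xP -linearZ_LR -(inj_eq (can_inj gK)) linear0 fK.
Qed.

Lemma injective_resolution_liniso d :
  injective_resolution N d -> injective_resolution N' d.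
Proof.
move: NN' => [f [g [fK gK]]] [I [eps [delta [II ei e0 ed Id]]]].
exists I, (eps \o g), delta; split=> // [|x].
  exact: inj_comp ei (can_inj gK).
split=> [/e0[y ->]|[y ->]]; first by exists (f y); rewrite /= fK.
by apply/e0; exists (g y).
Qed.

End IsoInvariants.

Lemma Ass_liniso (A : comNzRingType) (N N' : lmodType A) :
  liniso N N' -> Ass N = Ass N'.
Proof.
move=> e; apply/funext => P; apply/propext; split; apply: Ass_sub_liniso => //.
exact: liniso_sym.
Qed.

Lemma injdim_liniso (A : comNzRingType) (N N' : lmodType A) :
  liniso N N' -> injdim N = injdim N'.
Proof.
move=> e; have e' := liniso_sym e.
rewrite /injdim; congr (if _ then _ else infn _).
  apply/asbool_equiv_eq; move: e => [f [g [fK gK]]].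
  by split=> z x; [rewrite -(gK x) (z (g x)) linear0|rewrite -(fK x) (z (f x)) linear0].
by apply/seteqP; split=> d; exact: injective_resolution_liniso.
Qed.

Section LocMap.
Variables (A : comNzRingType) (P : prime_idealr A) (N N' : lmodType A).
Variable f : {linear N -> N'}.

Definition loc_map (w : locm P N) : locm P N' := lfrac (f (num w)) (den w).

Lemma loc_mapE x s : loc_map (lfrac x s) = lfrac (f x) s.
Proof.
have [u e] := numden x s; apply/frac_eq; exists u.
by rewrite !scalerA -!linearZ_LR e.
Qed.

Lemma loc_map_linear : linear loc_map.
Proof.
move=> a v w; have [c [r ->]] := fracrP a.
have [x [s ->]] := fracP v; have [y [t ->]] := fracP w.
have scE (V : lmodType A) (z : V) :
    fracr c r *: lfrac z s = lfrac (c *: z) (denomM r s) by exact: loc_scaleE.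
rewrite (scE N x).
rewrite (fracD (c *: x)).
rewrite !loc_mapE (scE N' (f x)) (fracD (c *: f x)); congr lfrac.
by rewrite (linearD f) !(linearZ_LR f).
Qed.
HB.instance Definition _ :=
  GRing.isLinear.Build (locr P) (locm P N) (locm P N') _ loc_map loc_map_linear.
End LocMap.

Lemma locm_liniso (A : comNzRingType) (P : prime_idealr A)
    (N N' : lmodType A) :
  liniso N N' -> liniso (locm P N : lmodType (locr P)) (locm P N').
Proof.
move=> [f [g [fK gK]]].
exists (@loc_map A P N N' f), (@loc_map A P N' N g).
by split=> w; have [x [s ->]] := fracP w; rewrite /= !loc_mapE ?fK ?gK.
Qed.

Lemma supp_liniso (A : comNzRingType) (N N' : lmodType A) P :
  liniso N N' -> supp N P -> supp N' P.
Proof.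
move=> /(locm_liniso P)[f [g [fK gK]]] [x x0]; exists (f x).
by rewrite -(linear0 f) (can_eq fK).
Qed.

Lemma supp_dim_liniso (A : comNzRingType) (N N' : lmodType A) :
  liniso N N' -> supp_dim N = supp_dim N'.
Proof.
move=> e; rewrite /supp_dim; congr (supn (prime_chain _)).
by apply/funext => P; apply/propext; split; apply: supp_liniso => //;
  exact: liniso_sym.
Qed.

(** * Functoriality of Ext in the second argument *)

Section ExtMap.
Variables (R : comNzRingType) (K N N' : lmodType R) (f : {linear N -> N'}).

Lemma post_linear (U : lmodType R) (h : Defs.hom U N) :
  linear (fun x => f (hom_fun h x)).
Proof. by move=> a x y; rewrite linearP (linearP f). Qed.
Definition post (U : lmodType R) (h : Defs.hom U N) : Defs.hom U N' :=
  hom_of (post_linear h).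

Lemma post_cocycle i (z : subm (@cocycle R K N i)) :
  post (\val z) \in @cocycle R K N' i.
Proof.
apply/asboolP => x; have /asboolP z0 := valP z.
rewrite [LHS]/(f (hom_fun (\val z) (res_diff x))) z0; exact: (linear0 f).
Qed.

(** Ext is a quotient of a module of cocycles, so the induced map is defined on
    cocycles and then descends by [ext_cochain0]. *)
Definition ext_cochain i (z : subm (@cocycle R K N i)) : Ext K N' i :=
  projm _ (subm_in (post_cocycle z)).

Lemma ext_cochain_linear i : linear (@ext_cochain i).
Proof.
move=> a y z; rewrite /ext_cochain -linearP; congr (projm _ _).
apply/val_inj/hom_ext => x.
have valE (s t : subm (@cocycle R K N i)) :
    hom_fun (\val (a *: s + t)) x = a *: hom_fun (\val s) x + hom_fun (\val t) x.
  exact: (hom_funP a (\val s) (\val t)).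
have valE' (s t : subm (@cocycle R K N' i)) :
    hom_fun (\val (a *: s + t)) x = a *: hom_fun (\val s) x + hom_fun (\val t) x.
  exact: (hom_funP a (\val s) (\val t)).
have fE w : hom_fun (\val (subm_in (post_cocycle w))) x = f (hom_fun (\val w) x).
  by [].
by rewrite valE' !fE valE (linearP f).
Qed.

Lemma ext_cochain0 i (z : subm (@cocycle R K N i)) :
  z \in @coboundary R K N i -> lin_of (@ext_cochain_linear i) z = 0.
Proof.
move=> zb; rewrite -[RHS](linear0 (projm (@coboundary R K N' i))).
apply/projm_eq; rewrite subr0; case: i z zb => [|i] z.
  move=> /eqP->; apply/eqP/val_inj/hom_ext => x.
  exact: (linear0 f).
move=> /asboolP[g zg]; apply/asboolP; exists (post g) => x.
by rewrite [LHS]/(f (hom_fun (\val z) x)) zg.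
Qed.

Definition ext_map i (x : Ext K N i) : Ext K N' i :=
  lin_of (@ext_cochain_linear i) (reprm x).
Lemma ext_map_linear i : linear (@ext_map i).
Proof. exact: (quotm_lift_linear (@ext_cochain0 i)). Qed.
HB.instance Definition _ i := 
  GRing.isLinear.Build R (Ext K N i) (Ext K N' i) _ (@ext_map i) (@ext_map_linear i).
Lemma ext_mapE i z : @ext_map i (projm _ z) = ext_cochain z.
Proof. exact: (quotm_liftE (@ext_cochain0 i)). Qed.
End ExtMap.

Lemma ext_mapK (R : comNzRingType) (K N N' : lmodType R)
    (f : {linear N -> N'}) (g : {linear N' -> N}) i :
  cancel f g -> cancel (@ext_map R K N N' f i) (@ext_map R K N' N g i).
Proof.
move=> fK x; rewrite -[x]projmK ext_mapE /ext_cochain ext_mapE.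
by congr (projm _ _); apply/val_inj/hom_ext => y; exact: fK.
Qed.

Lemma Ext_liniso (R : comNzRingType) (K N N' : lmodType R) i :
  liniso N N' -> liniso (Ext K N i) (Ext K N' i).
Proof.
move=> [f [g [fK gK]]]; exists (@ext_map R K N N' f i), (@ext_map R K N' N g i).
by split; exact: ext_mapK.
Qed.

(** A residue class acts on [bass_ext] as any of its representatives in the local
    ring, so linearity over the local ring gives linearity over the residue
    field. *)
Lemma bass_ext_liniso (A : comNzRingType) (P : prime_idealr A) i
    (N N' : lmodType A) : liniso N N' ->
  liniso (bass_ext P N i : lmodType (resfield P)) (bass_ext P N' i).
Proof.
move=> /(locm_liniso P)/(Ext_liniso (resfield P) i)[f [g [fK gK]]].
have fl : linear (f : bass_ext P N i -> bass_ext P N' i).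
  by move=> a x y; exact: (linearP f (rrepr a) x y).
have gl : linear (g : bass_ext P N' i -> bass_ext P N i).
  by move=> a x y; exact: (linearP g (rrepr a) x y).
by exists (lin_of fl), (lin_of gl).
Qed.

Lemma has_dim_liniso (k : nzRingType) (V W : lmodType k) (I : choiceType) :
  liniso V W -> has_dim V I -> has_dim W I.
Proof.
move=> [f [g [fK gK]]] [b [c bK cK]]; exists (f \o b).
have fbE x : fglift (f \o b) x = f (fglift b x).
  rewrite -[x]freeg_sumE !raddf_sum; apply: eq_bigr => z _.
  by rewrite /= !liftU linearZ_LR.
by exists (c \o g) => x; rewrite /= fbE ?fK ?bK // cK gK.
Qed.

(** * Bases over a field *)

(** [resfield] is only given as a commutative ring, which is why being a field is
    expressed by the hypothesis [kV]. *)
Section Basis.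
Variables (k : comNzRingType) (V : lmodType k).
Hypothesis kV : forall a : k, a != 0 -> exists b, b * a = 1.

Let supported (B : set V) (D : {freeg V / k}) := forall x, x \in dom D -> B x.
Definition free_set (B : set V) : Prop :=
  forall D : {freeg V / k}, supported B D -> fglift id D = 0 -> D = 0.

Lemma supportedP B D : (forall x, ~ B x -> coeff x D = 0) -> supported B D.
Proof.
move=> h x; rewrite mem_dom => /eqP xD; apply: contrapT => /h; exact: xD.
Qed.

Lemma supported_coeff B D x : supported B D -> ~ B x -> coeff x D = 0.
Proof.
move=> sD nB; apply/eqP; apply: contrapT => /negP xD; apply/nB/sD.
by rewrite mem_dom.
Qed.

(** The union of a chain of free sets is free because a linear relation involves
    finitely many vectors, which already lie in one member of the chain. *)
Lemma maximal_free_set : exists B : set V,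
  free_set B /\ forall B', B `<` B' -> ~ free_set B'.
Proof.
apply: Zorn_bigcup => F FP tot D sD D0.
(* The empty chain has no member; its union only supports 0. *)
have chain (s : seq V) : (forall x, x \in s -> (\bigcup_(X in F) X) x) ->
    exists2 X, (F X \/ s = [::]) & forall x, x \in s -> X x.
  elim: s => [|x s IHs] sF; first by exists set0; [right|].
  have [|X FX sX] := IHs; first by move=> y ys; apply: sF; rewrite inE ys orbT.
  have [Y FY Yx] := sF x (mem_head _ _).
  case: FX => [FX|s0]; last first.
    exists Y; first by left.
    by move=> y; rewrite inE s0 orbF => /eqP->.
  have [XY|YX] := tot _ _ FX FY.
    exists Y; first by left.
    by move=> y; rewrite inE => /predU1P[->|/sX/XY].
  exists X; first by left.
  by move=> y; rewrite inE => /predU1P[->|/sX//]; exact: YX.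
have [X FX sX] := chain _ sD.
case: FX => [FX|/eqP]; first exact: (FP _ FX).
by rewrite dom_eq0 => /eqP.
Qed.

(** If v is not in the span then adjoining v keeps the set free: a relation in which
    v has a nonzero coefficient can be solved for v. *)
Lemma maximal_free_set_span B : free_set B ->
  (forall B', B `<` B' -> ~ free_set B') ->
  forall v, exists2 D, supported B D & v = fglift id D.
Proof.
move=> fB maxB v; apply: contrapT => nv.
have nBv : ~ B v.
  move=> Bv; apply: nv; exists << v >>; last by rewrite liftU scale1r.
  by move=> x; rewrite domU1 inE => /eqP->.
apply: (maxB (B `|` [set v])).
  by split=> [x|/(_ v)]; [left|apply/contra_not: nBv => h; apply: h; right].
move=> D sD D0; have [c0|/kV[b bc]] := eqVneq (coeff v D) 0.
  apply: fB => // x xD; have [//|/= xv] := sD _ xD.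
  by move: xD; rewrite xv mem_dom c0 eqxx.
case: nv; exists (- b *: (D - coeff v D *: << v >>)); last first.
  have fE : fglift id (coeff v D *: << v >> : {freeg V / k}) = coeff v D *: v.
    by rewrite linearZ_LR /= liftU scale1r.
  rewrite linearZ_LR raddfB /= fE D0 sub0r scalerN.
  by rewrite scaleNr opprK scalerA bc scale1r.
apply: supportedP => x nBx; rewrite coeffZ coeffB coeffZ coeffU mul1r.
have [->|nvx] := eqVneq v x; first by rewrite mulr1 subrr mulr0.
rewrite mulr0 subr0 (supported_coeff sD) ?mulr0 // => -[//|/= xv].
by rewrite xv eqxx in nvx.
Qed.

Lemma exists_basis : exists I : choiceType, has_dim V I.
Proof.
have [B [fB maxB]] := maximal_free_set.
have span := maximal_free_set_span fB maxB.
pose I : choiceType := {x : V | `[< B x >]}.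
pose b : I -> V := fun i => sval i; exists I, b.
have ext (E : {freeg I / k}) : fglift b E =
    fglift id (\sum_(i <- dom E) << coeff i E *g b i >> : {freeg V / k}).
  rewrite -{1}[E]freeg_sumE !raddf_sum; apply: eq_bigr => i _.
  by rewrite /= !liftU.
have inj : injective (fglift b : {freeg I / k} -> V).
  apply: raddf_inj => E; rewrite /= ext => /fB h.
  apply/eqP/freeg_eqP => i; rewrite coeff0.
  have -> : coeff i E =
      coeff (b i) (\sum_(i <- dom E) << coeff i E *g b i >>).
    rewrite -{1}[E]freeg_sumE !raddf_sum; apply: eq_bigr => j _.
    by rewrite /= !coeffU.
  rewrite h ?coeff0 //; apply: supportedP => x nBx.
  rewrite raddf_sum big1 // => j _; rewrite /= coeffU.
  have [jx|_] := eqVneq (b j) x; last by rewrite mulr0.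
  by case: nBx; rewrite -jx; exact/asboolP/(svalP j).
have surj v : exists E : {freeg I / k}, fglift b E = v.
  have [D sD ->] := span v; rewrite -[D]freeg_sumE raddf_sum.
  move: sD; rewrite /supported; move: (dom D : seq V) => s.
  elim: s => [|x s IHs] sB; first by exists 0; rewrite raddf0 big_nil.
  have [|E eE] := IHs; first by move=> y ys; apply: sB; rewrite inE ys orbT.
  have Bx : `[< B x >] by apply/asboolP/sB/mem_head.
  exists (<< coeff x D *g (exist _ x Bx : I) >> + E).
  by rewrite raddfD /= eE big_cons !liftU.
have [c cP] := choice surj.
by exists c => [E|v]; [apply: inj|]; rewrite cP.
Qed.
End Basis.

Lemma resfield_inv (A : comNzRingType) (P : prime_idealr A) (a : resfield P) :
  a != 0 -> exists b, b * a = 1.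
Proof.
rewrite -[a]rreprK; have [x [s ->]] := fracrP (rrepr a) => a0.
have xP : x \notin P.
  apply: contraNN a0 => xP; apply/eqP/residue_eq0.
  by rewrite locmaxE.
exists (residue P (fracr (sval s) (exist (fun s => is_true (s \notin P)) x xP))).
rewrite -rmorphM fracrM -[RHS](rmorph1 (residue P)); congr (residue P _).
apply/fracr_eq; exists (denom1 P) => /=; by rewrite !mulr1 !mul1r mulrC.
Qed.

Lemma exists_bass_number (A : comNzRingType) (P : prime_idealr A) i
  (N : lmodType A) : exists I : choiceType, bass_number P i N I.
Proof. exact/exists_basis/resfield_inv. Qed.

(** * The Frobenius functor on modules *)

Section FrobTheory.
Variables (p : nat) (R : comNzRingType) (M : lmodType R).

Lemma frob_rel0 (y : {freeg (R * M)%type / R}) :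
  frob_rel p y -> projm (lspan (@frob_rel p R M)) y = 0.
Proof.
move=> ry; rewrite -[RHS](linear0 (projm (lspan (@frob_rel p R M)))).
by apply/projm_eq; rewrite subr0; exact: mem_lspan.
Qed.

Lemma tensDl r s (m : M) : tens p (r + s) m = tens p r m + tens p s m.
Proof.
apply/eqP; rewrite -subr_eq0 opprD addrA; apply/eqP.
by rewrite /tens -!projmB; exact/frob_rel0/FrobDl.
Qed.

Lemma tensDr r (m m' : M) : tens p r (m + m') = tens p r m + tens p r m'.
Proof.
apply/eqP; rewrite -subr_eq0 opprD addrA; apply/eqP.
by rewrite /tens -!projmB; exact/frob_rel0/FrobDr.
Qed.

Lemma tens_bal r a (m : M) : tens p r (a *: m) = tens p (r * a ^+ p) m.
Proof.
apply/esym/eqP; rewrite -subr_eq0; apply/eqP.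
by rewrite /tens -!projmB; exact/frob_rel0/FrobBal.
Qed.

Lemma tensZ a r (m : M) : a *: tens p r m = tens p (a * r) m.
Proof.
apply/esym/eqP; rewrite -subr_eq0; apply/eqP.
have -> : a *: tens p r m = projm _ (a *: << (r, m) >>) by exact: scalemE.
by rewrite /tens -!projmB; exact/frob_rel0/FrobZ.
Qed.

Lemma tens0l (m : M) : tens p 0 m = 0.
Proof. by rewrite -(mul0r 0) -tensZ scale0r. Qed.

Lemma tens_sum (t : frob p M) :
  exists s : seq (R * M), t = \sum_(c <- s) tens p c.1 c.2.
Proof.
rewrite -[t]projmK -[reprm t]freeg_sumE.
exists [seq (coeff z (reprm t) * z.1, z.2) | z <- dom (reprm t)].
rewrite [RHS]big_map raddf_sum; apply: eq_bigr => -[r m] _ /=.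
rewrite -tensZ; have -> : << coeff (r, m) (reprm t) *g (r, m) >> =
    coeff (r, m) (reprm t) *: << (r, m) >> :> {freeg (R * M)%type / R}.
  by apply/eqP/freeg_eqP => l; rewrite coeffZ !coeffU mulrA mulr1.
exact/esym/scalemE.
Qed.

Lemma tens_ind (Q : frob p M -> Prop) : Q 0 ->
  (forall t t', Q t -> Q t' -> Q (t + t')) -> (forall r m, Q (tens p r m)) ->
  forall t, Q t.
Proof.
move=> Q0 QD Qt t; have [s ->] := tens_sum t.
by elim/big_rec: _ => // c t' _; exact: QD.
Qed.

Section Lift.
Variables (W : lmodType R) (f : R -> M -> W).
Hypothesis fDl : forall r s m, f (r + s) m = f r m + f s m.
Hypothesis fZ : forall a r m, f (a * r) m = a *: f r m.
Hypothesis fD : forall r m m', f r (m + m') = f r m + f r m'.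
Hypothesis fB : forall r a m, f (r * a ^+ p) m = f r (a *: m).

(** The universal property of the tensor product defining the Frobenius functor. *)
Lemma frob_lift : exists h : {linear frob p M -> W},
  forall r m, h (tens p r m) = f r m.
Proof.
pose g : {linear {freeg (R * M)%type / R} -> W} :=
  fglift (fun z : R * M => f z.1 z.2).
have gE r m : g << (r, m) >> = f r m by rewrite /g/= liftU scale1r.
have g0 x : x \in lspan (@frob_rel p R M) -> g x = 0.
  apply: lspan_lift0 => {}x [r s m|r m m'|r a m|a r m].
  - by rewrite !(raddfB g) /= !gE fDl -addrA -opprD subrr.
  - by rewrite !(raddfB g) /= !gE fD -addrA -opprD subrr.
  - by rewrite (raddfB g) /= !gE fB subrr.
  - by rewrite (raddfB g) /= (linearZ_LR g) !gE fZ subrr.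
exists (lin_of (quotm_lift_linear g0)) => r m.
by rewrite -gE; exact: (quotm_liftE g0).
Qed.
End Lift.
End FrobTheory.

Lemma frob_liniso p (R : comNzRingType) (M N : lmodType R) :
  liniso M N -> liniso (frob p M) (frob p N).
Proof.
move=> [f [g [fK gK]]].
exists (@frob_map p R M N f), (@frob_map p R N M g); split; apply: tens_ind.
- by rewrite !raddf0.
- by move=> t t' e e'; rewrite !raddfD /= e e'.
- by move=> r m; rewrite /= !frob_mapE fK.
- by rewrite !raddf0.
- by move=> t t' e e'; rewrite !raddfD /= e e'.
- by move=> r m; rewrite /= !frob_mapE gK.
Qed.

(** The universal property [frob_lift] only yields R-linear maps.  To get maps
    from F(M) to an A-module G that are merely A-linear, one aims at the coinduced
    R-module Hom_A(R, G), where r acts on h by precomposition with multiplication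
    by r, and then evaluates at 1. *)
Section Coinduction.
Variables (A : comNzRingType) (n : nat) (G : lmodType A).

(** A separate name for the group of A-linear maps, since it already has a module
    structure over A and gets a different one over R here. *)
Definition coind : Type := Defs.hom ({mpoly A[n]} : lmodType A) G.
HB.instance Definition _ := GRing.Zmodule.on coind.

Lemma coind_scale_linear (r : {mpoly A[n]}) (h : coind) :
  linear (fun s : {mpoly A[n]} => hom_fun h (s * r)).
Proof. by move=> a s t; rewrite mulrDl -scalerAl linearP. Qed.
Definition coind_scale (r : {mpoly A[n]}) (h : coind) : coind :=
  hom_of (coind_scale_linear r h).

Let coind_scaleA r s h :
  coind_scale r (coind_scale s h) = coind_scale (r * s) h.
Proof.
apply: hom_ext => t.
by rewrite [LHS]/(hom_fun h (t * r * s)) -mulrA.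
Qed.
Let coind_scale1 : left_id 1 coind_scale.
Proof. by move=> h; apply: hom_ext => t; rewrite [LHS]/(hom_fun h (t * 1)) mulr1. Qed.
Let coind_scaleDr : right_distributive coind_scale +%R.
Proof. by move=> r h h'; apply: hom_ext. Qed.
Let coind_scaleDl h : {morph coind_scale^~ h : r s / r + s}.
Proof.
move=> r s; apply: hom_ext => t.
rewrite [LHS]/(hom_fun h (t * (r + s))) mulrDr; exact: hom_funD.
Qed.
HB.instance Definition _ := GRing.Zmodule_isLmodule.Build {mpoly A[n]} coind
  coind_scaleA coind_scale1 coind_scaleDr coind_scaleDl.
Lemma coind_funD (h h' : coind) s :
  hom_fun (h + h') s = hom_fun h s + hom_fun h' s.
Proof. by []. Qed.
End Coinduction.

(** The A-linear map with prescribed values on the monomials. *)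
Section MpolyLin.
Variables (A : comNzRingType) (n : nat) (G : lmodType A) (h : 'X_{1..n} -> G).
Definition mpoly_lin (r : {mpoly A[n]}) : G := fglift h (mpoly_val r).
Lemma mpoly_lin_linear : linear mpoly_lin.
Proof.
move=> a r s; exact: (fglift_linear h a (mpoly_val r) (mpoly_val s)).
Qed.
HB.instance Definition _ :=
  GRing.isLinear.Build A {mpoly A[n]} G _ mpoly_lin mpoly_lin_linear.
Lemma mpoly_linX m : mpoly_lin 'X_[m] = h m.
Proof. by rewrite /mpoly_lin unlock /mpolyX_def /= liftU scale1r. Qed.
End MpolyLin.

(** * Homogeneous components of a graded module *)

Section Degrees.
Variables (A : comNzRingType) (n : nat).
Local Notation deg := {ffun 'I_n -> int}.

Definition mnm_deg (m : 'X_{1..n}) : deg := [ffun j => (m j)%:Z].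

Lemma mdegreeX m (c : A) : mdegree (mnm_deg m) (c *: 'X_[m]).
Proof.
move=> k /msuppZ_le; rewrite msuppX inE => /eqP-> j.
by rewrite ffunE.
Qed.

(** The degree of a monomial determines its exponents, so only one monomial can
    occur in r. *)
Lemma mdegreeP (u : deg) (r : {mpoly A[n]}) : mdegree u r ->
  r = 0 \/ exists m c, u = mnm_deg m /\ r = c *: 'X_[m].
Proof.
move=> ur; case E: (msupp r) => [|m s]; first by left; exact: msuppnil0.
have mr : m \in msupp r by rewrite E mem_head.
right; exists m, r@_m; split; first by apply/ffunP => j; rewrite ffunE -(ur m).
apply/mpolyP => k; rewrite mcoeffZ mcoeffX.
have [<-|nmk] := eqVneq m k; first by rewrite mulr1.
rewrite mulr0; apply: memN_msupp_eq0; apply: contraNN nmk => kr.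
by apply/eqP/mnmP => j; apply/eqP; rewrite -eqz_nat (ur m mr) (ur k kr).
Qed.

Section Projection.
Variables (M : lmodType {mpoly A[n]}) (g : zgrading M).

Lemma zcompN u x : g u x -> g u (- x).
Proof. by move=> gx; rewrite -sub0r; apply: zcompB => //; exact: zcomp0. Qed.

Lemma zcompD u x y : g u x -> g u y -> g u (x + y).
Proof.
by move=> gx gy; rewrite -[y]opprK; apply: zcompB => //; exact: zcompN.
Qed.

Lemma zcomp_bigsum u (I : eqType) (s : seq I) (Q : pred I) (f : I -> M) :
  (forall i, i \in s -> Q i -> g u (f i)) -> g u (\sum_(i <- s | Q i) f i).
Proof.
move=> gf; rewrite big_seq_cond; apply: big_ind; first exact: zcomp0.
  by move=> x y; exact: zcompD.
by move=> i /andP[]; exact: gf.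
Qed.

Lemma zcompZX u v m c x : g v x -> u = mnm_deg m + v -> g u (c *: 'X_[m] *: x).
Proof. by move=> gx ->; apply: zcompZ => //; exact: mdegreeX. Qed.

Lemma zcompZC v (c : A) x : g v x -> g v (c%:MP_[n] *: x).
Proof.
move=> gx; have -> : c%:MP_[n] = c *: 'X_[0%MM].
  by rewrite -mul_mpolyC mpolyX0 mulr1.
apply: zcompZX (gx) _; rewrite -[LHS]add0r; congr (_ + _).
by apply/ffunP => j; rewrite !ffunE mnm0E.
Qed.

(** The sum of the components of degree other than v.  It is described by lists of
    homogeneous elements in which degrees may repeat, so that closure under
    addition is concatenation. *)
Definition off_degree (v : deg) (x : M) : Prop := exists s : seq (deg * M),
  (forall c, c \in s -> c.1 != v /\ g c.1 c.2) /\ x = \sum_(c <- s) c.2.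

Lemma off_degreeD v x y :
  off_degree v x -> off_degree v y -> off_degree v (x + y).
Proof.
move=> [s [sP ->]] [t [tP ->]]; exists (s ++ t); rewrite big_cat; split=> // c.
by rewrite mem_cat => /orP[/sP|/tP].
Qed.

Lemma off_degreeZ v (a : A) x : off_degree v x -> off_degree v (a%:MP_[n] *: x).
Proof.
move=> [s [sP ->]]; exists [seq (c.1, a%:MP_[n] *: c.2) | c <- s].
rewrite big_map scaler_sumr; split=> // c /mapP[d /sP[dv gd] ->].
by split=> //; exact: zcompZC.
Qed.

Lemma off_degreeN v x : off_degree v x -> off_degree v (- x).
Proof. by move=> /(off_degreeZ (- 1)); rewrite raddfN /= mpolyC1 scaleN1r. Qed.

(** Grouping the terms of x by degree turns x = sum into a relation between
    components of distinct degrees, to which directness of the grading applies. *)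
Lemma off_degree0 v x : g v x -> off_degree v x -> x = 0.
Proof.
move=> gx [s [sP sx]]; pose U := v :: undup [seq c.1 | c <- s].
pose f u := if u == v then - x else \sum_(c <- s | c.1 == u) c.2.
have vs : v \notin undup [seq c.1 | c <- s].
  by rewrite mem_undup; apply/negP => /mapP[c /sP[/eqP cv _]] /esym.
have uU : uniq U by rewrite /= vs undup_uniq.
have gf u : g u (f u).
  rewrite /f; case: eqVneq => [->|_]; first exact: zcompN.
  by apply: zcomp_bigsum => c /sP[_ gc] /eqP<-.
have sf : \sum_(u <- U) f u = 0.
  rewrite big_cons {1}/f eqxx; apply/eqP; rewrite addrC subr_eq0 sx; apply/eqP.
  transitivity (\sum_(u <- undup [seq c.1 | c <- s])
                  \sum_(c <- s) if c.1 == u then c.2 else 0).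
    apply: eq_big_seq => u us; rewrite /f; case: eqVneq => [uv|_].
      by rewrite uv (negPf vs) in us.
    by rewrite big_mkcond.
  rewrite exchange_big; apply: eq_big_seq => c cs; rewrite -big_mkcond /=.
  rewrite -big_filter.
  have -> : [seq i <- undup [seq c0.1 | c0 <- s] | c.1 == i] = [:: c.1].
    rewrite (eq_filter (a2 := pred1 c.1)); last by move=> i; rewrite eq_sym.
    rewrite filter_pred1_uniq ?undup_uniq // mem_undup.
    by apply/mapP; exists c.
  by rewrite big_seq1.
have := zcomp_direct uU gf sf (mem_head _ _).
by rewrite /f eqxx => /eqP; rewrite oppr_eq0 => /eqP.
Qed.

Lemma zproj_ex v x : exists y, g v y /\ off_degree v (x - y).
Proof.
have [s [f [gf ->]]] := zcomp_sum g x.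
exists (\sum_(u <- s | u == v) f u); split.
  by apply: zcomp_bigsum => u _ /eqP<-.
rewrite [X in X - _](bigID (pred1 v)) /= addrAC subrr add0r.
exists [seq (u, f u) | u <- s & u != v]; rewrite big_map big_filter.
by split=> // c /mapP[u]; rewrite mem_filter => /andP[uv _] ->.
Qed.

Definition zproj v x : M := sval (cid (zproj_ex v x)).

Lemma zproj_homog v x : g v (zproj v x).
Proof. by rewrite /zproj; case: cid => y []. Qed.

Lemma zprojE v x y : g v y -> off_degree v (x - y) -> zproj v x = y.
Proof.
move=> gy oy; rewrite /zproj; case: cid => z [gz oz] /=.
apply/eqP; rewrite -subr_eq0; apply/eqP; apply: (@off_degree0 v).
  exact: zcompB.
have -> : z - y = x - y - (x - z) by rewrite opprB [RHS]addrC subrKA.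
by apply: off_degreeD => //; exact: off_degreeN.
Qed.

Lemma zproj_id v x : g v x -> zproj v x = x.
Proof.
move=> gx; apply: zprojE => //; rewrite subrr.
by exists [::]; rewrite big_nil.
Qed.

Definition comp_proj v (x : scalarA M) : component g v :=
  subm_in (S := comp_pred g v) (asboolT (zproj_homog v x)).

Lemma comp_proj_linear v : linear (@comp_proj v).
Proof.
move=> a x y; apply: val_inj.
rewrite [LHS]/(zproj v (a%:MP_[n] *: (x : M) + (y : M))).
rewrite [RHS]/(a%:MP_[n] *: zproj v x + zproj v y).
have oP z : off_degree v (z - zproj v z) by rewrite /zproj; case: cid => ? [].
apply: zprojE.
  by apply: zcompD; [apply: zcompZC|]; exact: zproj_homog.
rewrite opprD addrACA -scalerBr; apply: off_degreeD; last exact: oP.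
by apply: off_degreeZ; exact: oP.
Qed.
HB.instance Definition _ v := GRing.isLinear.Build A (scalarA M) (component g v)
  _ (@comp_proj v) (@comp_proj_linear v).

Lemma comp_proj_id v (x : component g v) : comp_proj v (\val x) = x.
Proof. by apply: val_inj; apply: zproj_id; exact/asboolP/(valP x). Qed.

End Projection.
End Degrees.

(** * The graded pieces of the Frobenius functor *)

Section GradedFrobenius.
Variables (A : comNzRingType) (n p : nat) (pA : p \in [pchar A]).
Local Notation R := {mpoly A[n]}.
Local Notation deg := {ffun 'I_n -> int}.
Variables (M : lmodType R) (g : zgrading M).

Let p_gt0 : (0 < p)%N. Proof. exact/prime_gt0/(pcharf_prime pA). Qed.

Lemma mpoly_exprD (a b : R) : (a + b) ^+ p = a ^+ p + b ^+ p.
Proof.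
have pR : p \in [pchar R] by exact: (rmorph_pchar (@mpolyC n A)).
exact: (pFrobenius_autD_comm pR (mulrC a b)).
Qed.

Variables (v : deg) (u : 'X_{1..n}) (hu : forall j, (u j < p)%N).
Let w : deg := mnm_deg u + v *+ p.
Local Notation G := (frob p (component g v)).

Definition mnm_div (m : 'X_{1..n}) : 'X_{1..n} := [multinom (m j %/ p)%N | j < n].

(** The value of the retraction at X^m (x) x.  Only exponents m = u + p k contribute;
    then X^m (x) x = X^u (x) X^k x, and the component of X^k x of degree v is the
    relevant one. *)
Definition retract_mon (x : M) (m : 'X_{1..n}) : G :=
  if [forall j, (m j %% p)%N == u j]
  then tens p 1 (comp_proj g v ('X_[mnm_div m] *: x : M)) else 0.

Definition retract (r : R) (x : M) : G := mpoly_lin (retract_mon x) r.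

Lemma retractX c m x : retract (c *: 'X_[m]) x = c *: retract_mon x m.
Proof. by rewrite /retract linearZ_LR /= mpoly_linX. Qed.

Lemma retractDl r s x : retract (r + s) x = retract r x + retract s x.
Proof. exact: (linearD (mpoly_lin (retract_mon x)) r s). Qed.

Lemma retract_monD x y m :
  retract_mon (x + y) m = retract_mon x m + retract_mon y m.
Proof.
rewrite /retract_mon; case: ifP => _; last by rewrite addr0.
by rewrite scalerDr (linearD (comp_proj g v)) tensDr.
Qed.

Lemma retractDr r x y : retract r (x + y) = retract r x + retract r y.
Proof.
elim/mpolyind: r => [|c m r _ _ IHr]; first by rewrite /retract !linear0 addr0.
by rewrite !retractDl IHr !retractX retract_monD scalerDr addrACA.
Qed.

(** By additivity r and a may be taken to be terms.  Multiplying X^m by X^(p k) keeps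
    the residues of the exponents and adds k to the quotients, which is the effect
    of moving X^k to the right factor; coefficients are raised to the p-th power on
    both sides. *)
Lemma retract_bal r a x : retract (r * a ^+ p) x = retract r (a *: x).
Proof.
elim/mpolyind: r => [|c m r _ _ IHr]; first by rewrite mul0r /retract !linear0.
rewrite mulrDl !retractDl IHr; congr (_ + _) => {r IHr}.
elim/mpolyind: a => [|d k a _ _ IHa].
  rewrite scale0r expr0n eqn0Ngt p_gt0 mulr0.
  have r0 r : retract r 0 = 0.
    by apply: (addrI (retract r 0)); rewrite -retractDr !addr0.
  by rewrite r0 /retract linear0.
rewrite mpoly_exprD mulrDr retractDl IHa scalerDl retractDr; congr (_ + _).
have -> : c *: 'X_[m] * (d *: 'X_[k]) ^+ p = (c * d ^+ p) *: 'X_[m + k *+ p] :> R.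
  by rewrite exprZn mpolyXn -scalerAl -scalerAr scalerA mpolyXD.
rewrite !retractX /retract_mon.
have -> : [forall j, ((m + k *+ p)%MM j %% p)%N == u j]
        = [forall j, (m j %% p)%N == u j].
  by apply: eq_forallb => j; rewrite mnmDE mulmnE addnC modnMDl.
case: ifP => _; last by rewrite !scaler0.
have -> : mnm_div (m + k *+ p) = (mnm_div m + k)%MM.
  by apply/mnmP => j; rewrite !(mnmE, mnmDE) mulmnE addnC divnMDl // addnC.
have -> : 'X_[mnm_div m] *: (d *: 'X_[k] *: x)
        = d%:MP_[n] *: ('X_[mnm_div m + k] *: x).
  by rewrite !scalerA mul_mpolyC mpolyXD -scalerAr.
have -> z : comp_proj g v (d%:MP_[n] *: z : M) = d *: comp_proj g v z.
  exact: (linearZ_LR (comp_proj g v) d z).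
by rewrite tens_bal mul1r -scalerA tensZ mulr1.
Qed.

Lemma graded_retraction : exists rho : {linear scalarA (frob p M) -> G},
  forall r x, rho (tens p r x) = retract r x.
Proof.
pose ev (r : R) (x : M) : coind n G :=
  coind_scale r (hom_of (mpoly_lin_linear (retract_mon x))).
have evE r x s : hom_fun (ev r x) s = retract (s * r) x by [].
have [||||h hE] := @frob_lift p R M (coind n G) ev.
- by move=> r s x; rewrite /ev; exact: (scalerDl _ r s).
- by move=> a r x; rewrite /ev; exact: esym (scalerA a r _).
- by move=> r x y; apply: hom_ext => s; rewrite coind_funD !evE; exact: retractDr.
- by move=> r a x; apply: hom_ext => s; rewrite !evE mulrA retract_bal.
have lh : linear (fun t : scalarA (frob p M) => hom_fun (h t : coind n G) 1).
  move=> a t t'.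
  have -> : h (a *: t + t') = a%:MP_[n] *: h t + h t' by exact: linearP.
  rewrite coind_funD; congr (_ + _).
  rewrite [LHS]/(hom_fun (h t : coind n G) (1 * a%:MP_[n])) mul1r.
  rewrite -[a%:MP_[n]]mulr1 mul_mpolyC; exact: (linearZ_LR (hom_fun (h t : coind n G))).
exists (lin_of lh) => r x.
by rewrite [LHS]/(hom_fun (h (tens p r x)) 1) hE [LHS]evE mul1r.
Qed.

Lemma graded_section : exists iota : {linear G -> scalarA (frob p M)},
  forall a x, iota (tens p a x) = tens p (a *: 'X_[u]) (\val x : M).
Proof.
apply: (@frob_lift p A (component g v) (scalarA (frob p M))).
- by move=> a b x; rewrite scalerDl tensDl.
- move=> a b x; rewrite -scalerA -mul_mpolyC; exact/esym/tensZ.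
- by move=> a x y; rewrite [\val (x + y)]/(\val x + \val y) tensDr.
move=> a b x.
rewrite [\val (b *: x)]/(b%:MP_[n] *: (\val x : M)) tens_bal -rmorphXn /=.
by rewrite [_ *: _ * _]mulrC mul_mpolyC scalerA [_ * a]mulrC.
Qed.

Lemma frob_degD x y : frob_deg g w x -> frob_deg g w y ->
  @frob_deg A n p M g w (x + y).
Proof.
move=> [s sP ->] [t tP ->]; exists (s ++ t); last by rewrite big_cat.
by move=> c; rewrite mem_cat => /orP[/sP|/tP].
Qed.

(** Two expansions of w with remainder u and with exponent m: since u_j < p, the
    remainder and the quotient of m_j are forced, even though v' may be
    negative. *)
Lemma mnm_deg_floor (m : 'X_{1..n}) (v' : deg) : w = mnm_deg m + v' *+ p ->
  (forall j, (m j %% p)%N = u j) /\ v = mnm_deg (mnm_div m) + v'.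
Proof.
move=> e; have ej j : (u j)%:Z + v j * p%:Z = (m j)%:Z + v' j * p%:Z.
  by have /ffunP/(_ j) := e; rewrite /w !ffunE !ffunMnE !pmulrn !mulrzz.
have key j : (m j %% p)%N = u j /\ v j = (m j %/ p)%N%:Z + v' j.
  have hm := divn_eq (m j) p; have hlt := ltn_pmod (m j) p_gt0.
  move: (ej j) (hu j) hm hlt p_gt0.
  move: (m j) (u j) (v j) (v' j) (m j %% p)%N (m j %/ p)%N => a b c d r q.
  move=> e1 hu1 e2 hr hp.
  (* The remainders u_j and r differ by a multiple of p and both lie in [0, p). *)
  have e3 : (b%:Z - r%:Z) = (d + q%:Z - c) * p%:Z by nia.
  have [d0|[d0|d0]] : d + q%:Z - c = 0 \/ (1 <= d + q%:Z - c \/ d + q%:Z - c <= -1)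
    by lia.
  - by rewrite d0 in e3; lia.
  - by nia.
  - by nia.
split=> [j|]; first by have [] := key j.
by apply/ffunP => j; rewrite !ffunE mnmE; have [] := key j.
Qed.

(** F_A(M_v) is isomorphic to F(M)_w.  The map [rho] is a left inverse of [iota] on
    the nose; the other composite is the identity only on degree w, as [rho] kills
    the other degrees. *)
Lemma graded_frob_iso :
  exists (rho : {linear scalarA (frob p M) -> G})
         (iota : {linear G -> scalarA (frob p M)}),
  [/\ cancel iota rho, forall t, frob_deg g w (iota t) &
      forall t : frob p M, frob_deg g w t -> iota (rho t) = t].
Proof.
have [rho rhoE] := graded_retraction; have [iota iotaE] := graded_section.
exists rho, iota; split.
- apply: tens_ind; first by rewrite !linear0.
    by move=> t t' e e'; rewrite (linearD iota) (linearD rho) e e'.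
  move=> a x; rewrite iotaE rhoE retractX /retract_mon.
  have -> : [forall j, (u j %% p)%N == u j].
    by apply/forallP => j; rewrite modn_small.
  have -> : mnm_div u = 0%MM by apply/mnmP => j; rewrite !mnmE divn_small.
  by rewrite mpolyX0 scale1r comp_proj_id tensZ mulr1.
- apply: tens_ind.
  + by rewrite linear0; exists [::]; rewrite ?big_nil.
  + by move=> t t' e e'; rewrite (linearD iota); exact: frob_degD.
  + move=> a x; rewrite iotaE; exists [:: (a *: 'X_[u], \val x : M)].
      move=> c; rewrite inE => /eqP->; exists (mnm_deg u), v; split=> //.
        exact: mdegreeX.
      exact/asboolP/(valP x).
    by rewrite big_seq1.
move=> _ [s sP ->].
have -> : rho (\sum_(c <- s) tens p c.1 c.2) = \sum_(c <- s) rho (tens p c.1 c.2).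
  exact: raddf_sum.
rewrite (raddf_sum iota); apply: eq_big_seq => -[r x] /sP[u' [v' [/= ru xv e]]].
rewrite rhoE; have [->|[m [c [u'm ->]]]] := mdegreeP ru.
  by rewrite /retract linear0 linear0 tens0l.
rewrite u'm in e; have [mu vE] := mnm_deg_floor e.
rewrite retractX /retract_mon.
have -> : [forall j, (m j %% p)%N == u j] by apply/forallP => j; rewrite mu.
rewrite tensZ iotaE mulr1.
have -> : \val (comp_proj g v ('X_[mnm_div m] *: x)) = 'X_[mnm_div m] *: x.
  apply: zproj_id; rewrite -['X_[_]]scale1r; exact: zcompZX xv vE.
rewrite tens_bal mpolyXn -scalerAl -mpolyXD; congr (tens p (_ *: 'X_[_]) _).
by apply/mnmP => j; rewrite mnmDE mulmnE mnmE -mu addnC -divn_eq.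
Qed.

End GradedFrobenius.

(** * Components of a graded F-finite module *)

Section FrobDegreeMap.
Variables (A : comNzRingType) (n p : nat).
Local Notation R := {mpoly A[n]}.
Local Notation deg := {ffun 'I_n -> int}.

Lemma frob_deg_map (V W : lmodType R) (gV : deg -> set V) (gW : deg -> set W)
    (f : {linear V -> W}) : (forall u x, gV u x -> gW u (f x)) ->
  forall w (t : frob p V), frob_deg gV w t -> frob_deg gW w (frob_map f t).
Proof.
move=> fg w _ [s sP ->]; exists [seq (c.1, f c.2) | c <- s].
  move=> _ /mapP[c /sP[u [v [ru xv e]]] ->].
  by exists u, v; split=> //; exact: fg.
rewrite big_map (raddf_sum (@frob_map p R V W f)); apply: eq_bigr => c _.
exact: frob_mapE.
Qed.

Lemma frob_trans_deg (U : lmodType R) (gU : zgrading U)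
    (b : {linear U -> frob p U}) :
  (forall u x, gU u x -> frob_deg gU u (b x)) ->
  forall e u x, frob_iter_deg gU e u x ->
    frob_iter_deg gU e.+1 u (frob_trans b e x).
Proof.
move=> bg; elim=> [|e IHe] u x; first exact: bg.
exact: (frob_deg_map (f := frob_trans b e)).
Qed.

Variables (M : lmodType R) (theta : {linear M -> frob p M}) (gM : zgrading M).
Hypothesis hM : graded_F_finite theta gM.

(** An element of degree u coming from F^e(V) is replaced by its image in
    F^(e+1)(V) = F(F^e(V)), on which theta is F of the map to M. *)
Lemma theta_deg u x : gM u x -> frob_deg gM u (theta x).
Proof.
have [V [gV [b [phi [_ bg [phiE _] thetaE gE]]]]] := hM.
move=> /gE[e [y [yu ->]]]; rewrite -phiE thetaE.
have phig v z : frob_iter_deg gV e v z -> gM v (phi e z).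
  by move=> zv; apply/gE; exists e, z.
apply: (frob_deg_map phig).
exact: (frob_trans_deg bg).
Qed.

Hypothesis theta_bij : bijective theta.

(** It suffices to find a preimage in degree u of each r (x) m.  As m is the image of
    some z in F^k(V), the image in M of r (x) z in F^(k+1)(V) is one. *)
Lemma theta_deg_inv u x : frob_deg gM u (theta x) -> gM u x.
Proof.
have [V [gV [b [phi [_ bg [phiE _] thetaE gE]]]]] := hM.
move=> [s sP /esym].
have {sP} [y yu <-] : exists2 y, gM u y & theta y = \sum_(c <- s) tens p c.1 c.2.
  elim: s sP => [|[r m] s IHs] sP.
    by exists 0; [exact: zcomp0|rewrite linear0 big_nil].
  have [|y yu ye] := IHs; first by move=> c cs; apply: sP; rewrite inE cs orbT.
  have [u' [v' [/= ru mv e]]] := sP _ (mem_head _ _).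
  have /gE[k [z [zv mE]]] := mv.
  exists (phi k.+1 (tens p r z : frob p (frob_iter p V k)) + y); last first.
    by rewrite linearD thetaE frob_mapE -mE ye big_cons.
  apply: zcompD => //; apply/gE; exists k.+1, (tens p r z); split=> //.
  exists [:: (r, z)]; last by rewrite big_seq1.
  by move=> c; rewrite inE => /eqP->; exists u', v'.
by move=> /(bij_inj theta_bij)<-.
Qed.

Hypothesis pA : p \in [pchar A].

Lemma component_frob (v : deg) (u : 'X_{1..n}) : (forall j, (u j < p)%N) ->
  liniso (component gM (mnm_deg u + v *+ p)) (frob p (component gM v)).
Proof.
move=> hu; have [rho [iota [iotaK iota_deg rhoK]]] := graded_frob_iso pA gM v hu.
have [thi thK thiK] := theta_bij.
set w := mnm_deg u + v *+ p in iota_deg rhoK *.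
have theta_w (x : component gM w) : frob_deg gM w (theta (\val x)).
  exact/theta_deg/asboolP/(valP x).
pose f (x : component gM w) : frob p (component gM v) := rho (theta (\val x)).
have fl : linear f.
  move=> a x y; rewrite /f.
  have -> : theta (\val (a *: x + y)) =
      a *: (theta (\val x) : scalarA (frob p M)) + theta (\val y).
    exact: (linearP theta a%:MP_[n] (\val x : M) (\val y : M)).
  exact: (linearP rho).
have iota_thi y : thi (iota y) \in comp_pred gM w.
  by apply/asboolP/theta_deg_inv; rewrite thiK.
apply: (@liniso_bij _ _ _ (lin_of fl)).
exists (fun y => subm_in (iota_thi y)) => [x|y].
  by apply: val_inj => /=; rewrite /f rhoK ?thK.
by rewrite /= /f /= thiK iotaK.
Qed.

(** Induction on k: the coordinatewise quotients by p stay in the orthant and are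
    bounded by p^k when the degrees are bounded by p^(k+1).  For k = 0 each coordinate
    is 0 or -1, as decided by U. *)
Lemma component_orthant_bounded (U : {set 'I_n}) k u v :
  orthant U u -> orthant U v ->
  (forall j, - (p ^ k)%N%:Z <= u j < (p ^ k)%N%:Z) ->
  (forall j, - (p ^ k)%N%:Z <= v j < (p ^ k)%N%:Z) ->
  liniso (component gM u) (component gM v).
Proof.
have p_gt1 : (1 < p)%N := prime_gt1 (pcharf_prime pA).
elim: k u v => [|k IHk] u v uU vU uk vk.
  suff -> : u = v by exact: liniso_refl.
  apply/ffunP => j; have := uU j; have := vU j; have := uk j; have := vk j.
  by case: ifP => _; rewrite expn0; move: (u j) (v j) => a b; lia.
pose q (w : deg) : deg := [ffun j => (w j %/ p%:Z)%Z].
pose r (w : deg) : 'X_{1..n} := [multinom `|(w j %% p%:Z)%Z|%N | j < n].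
have p0 : p%:Z != 0 by lia.
have rP w j : (r w j < p)%N.
  by rewrite mnmE; have := modz_ge0 (w j) p0; have := ltz_pmod (w j) (d := p%:Z); lia.
have wE w : w = mnm_deg (r w) + q w *+ p.
  apply/ffunP => j; rewrite !ffunE !ffunMnE !ffunE pmulrn mulrzz mnmE.
  by rewrite {1}(divz_eq (w j) p%:Z) gez0_abs ?modz_ge0 // addrC.
have qP w : orthant U w -> (forall j, - (p ^ k.+1)%N%:Z <= w j < (p ^ k.+1)%N%:Z) ->
    orthant U (q w) /\ forall j, - (p ^ k)%N%:Z <= q w j < (p ^ k)%N%:Z.
  move=> wU wk.
  have key j : w j = q w j * p%:Z + (w j %% p%:Z)%Z.
    by rewrite ffunE -divz_eq.
  have rj j : 0 <= (w j %% p%:Z)%Z < p%:Z.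
    by rewrite modz_ge0 //= ltz_pmod; lia.
  split=> j; move: (wk j) (key j) (rj j); rewrite expnS.
    by have := wU j; case: ifP => _ *; nia.
  by move: (p ^ k)%N => N *; nia.
rewrite [u]wE [v]wE.
apply: liniso_trans (component_frob (q u) (rP u)) _.
apply: liniso_trans (liniso_sym (component_frob (q v) (rP v))).
have [qu quk] := qP u uU uk; have [qv qvk] := qP v vU vk.
exact/frob_liniso/IHk.
Qed.

Lemma component_orthant (U : {set 'I_n}) u v : orthant U u -> orthant U v ->
  liniso (component gM u) (component gM v).
Proof.
have p_gt1 : (1 < p)%N := prime_gt1 (pcharf_prime pA).
pose N := (\sum_j (`|u j| + `|v j|)).+1%N.
(* N bounds every coordinate, and N < p^N. *)
have bound j : (`|u j| + `|v j| < p ^ N)%N.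
  apply: leq_trans (ltnW (ltn_expl N p_gt1)).
  by rewrite ltnS (bigD1 j) //= leq_addr.
move=> uU vU; apply: (component_orthant_bounded (k := N)) uU vU _ _ => j;
  by have := bound j; lia.
Qed.
End FrobDegreeMap.

(** * Constancy on orthants *)

Theorem theoremC
    (A : comNzRingType) (hA : regular_ring A)
    (k : fieldType) (p : nat) (hp : p \in [pchar k]) (iota : {rmorphism k -> A})
    (n : nat) (M : lmodType {mpoly A[n]})
    (theta : {linear M -> frob p M}) (htheta : bijective theta)
    (gM : zgrading M) (hM : graded_F_finite theta gM)
    (U : {set 'I_n}) :
  (forall (P : prime_idealr A) (i : nat), exists I : choiceType,
     forall u, orthant U u -> bass_number P i (component gM u) I) /\
  (forall u v, orthant U u -> orthant U v ->
     [/\ injdim (component gM u) = injdim (component gM v),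
         supp_dim (component gM u) = supp_dim (component gM v) &
         Ass (component gM u) = Ass (component gM v)]).
Proof.
have pA : p \in [pchar A] := rmorph_pchar iota hp.
have iso u v := component_orthant hM htheta pA (U := U) (u := u) (v := v).
split=> [P i|u v uU vU]; last first.
  by split; [apply: injdim_liniso|apply: supp_dim_liniso|apply: Ass_liniso];
    exact: iso.
pose u0 : {ffun 'I_n -> int} := [ffun j => if j \in U then 0 else -1].
have u0U : orthant U u0 by move=> j; rewrite /u0; case: ifP => jU; rewrite ffunE jU.
have [I dimI] := exists_bass_number P i (component gM u0).
by exists I => u uU; apply: has_dim_liniso dimI; exact/bass_ext_liniso/iso.
Qed.
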